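(* Let $M\subseteq\mathbb{R}^d$ be an open domain, $T>0$, and let $u_t,\sigma_{1,t},\dots,\sigma_{J,t}$, $t\in[0,T]$, be time-dependent vector fields on $M$, smooth in time and space, such that $\sigma_{1,t}(x),\dots,\sigma_{J,t}(x)$ span $\mathbb{R}^d$ for all $t\in[0,T]$ and $x\in M$. Consider the Stratonovich SDE $$d\varphi_t=u_t(\varphi_t)\,dt+\sum_{r=1}^J\sigma_{r,t}(\varphi_t)\circ dW^r .$$ Let $g_t$ be the Riemannian metric on $M$ with cometric $g_t^*=\sum_{r=1}^J\sigma_{r,t}\otimes\sigma_{r,t}$, let $\nabla^t$ be its Levi-Civita connection, and let $z_t$ be the vector field determined by $$\frac12\sum_{r=1}^J\sigma_{r,t}^2+u_t=\frac12\Delta_{g_t}+z_t .$$ Let $$f_t=\frac12\operatorname{div}_{g_t}z_t-\frac1{12}S_t+\frac14\operatorname{tr}_{g_t}\dot g_t ,$$ where $S_t$ is the scalar curvature of $g_t$. Define operators $\dot g_t^*,(\nabla^t\xi)^*:TM\to TM$ by $$\langle\dot g_t^*\xi_1,\xi_2\rangle_{g_t}=\dot g_t(\xi_1,\xi_2),\qquad \langle(\nabla^t\xi)^*\xi_1,\xi_2\rangle_{g_t}=\langle\nabla^t_{\xi_2}\xi,\xi_1\rangle_{g_t}$$ for vector fields $\xi,\xi_1,\xi_2$. Then $\varphi_t$ is a most probable flow of the SDE if and only if it solves the equation $$\dot\varphi_t=(w_t+z_t)(\varphi_t)$$ with $w_t$ a time-dependent vector field on $M$ satisfying $$\dot w_t+\nabla^t_{w_t+z_t}w_t+\dot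 g_t^*w_t+(\nabla^tz_t)^*w_t=\nabla^tf_t .$$
   Context: Vector fields are identified with first-order differential operators, so $\sigma_{r,t}^2$ is the second-order operator $h\mapsto\sigma_{r,t}(\sigma_{r,t}h)$; $\Delta_{g_t}$ is the Laplace-Beltrami operator of $g_t$. A dot denotes the time derivative; $\dot g_t$ is the time derivative of the metric tensor $g_t$, and $\dot g_t^*$ is the operator defined in the claim (not the time derivative of the cometric). $\nabla^tf_t$ denotes the gradient of $f_t$ with respect to $g_t$. Onsager-Machlup functional: for a curve $\gamma:[0,T]\to M$ it is $\int_0^TH(t,\gamma_t,\dot\gamma_t)\,dt$ with $$H(t,\gamma,\dot\gamma)=\frac12\|\dot\gamma_t-z_t(\gamma_t)\|_{g_t}^2+f_t(\gamma_t).$$ Most probable path: a path between two given points that minimizes the Onsager-Machlup functional among paths on $[0,T]$ connecting these points. Most probable flow: a curve $[0,T]\ni t\mapsto\varphi_t$ of diffeomorphisms of $M$ such that for every $x\in M$ the curve $\gamma_t=\varphi_t(x)$ is a most probable path between its end points.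
   Formalization: The literal ''if'' is false (solutions of the equation need not minimize), so it is shown that most probable (minimizing) flows solve the equation, and that solving it is equivalent to each curve being stationary for the Onsager-Machlup functional with fixed end points. *)

(* Defs.v *)
From mathcomp Require Import all_boot all_order all_algebra.
From mathcomp Require Import all_classical all_reals all_analysis.

Set Implicit Arguments.
Unset Strict Implicit.
Unset Printing Implicit Defensive.

Import Order.TTheory GRing.Theory Num.Theory.
Import numFieldNormedType.Exports.

Local Open Scope classical_set_scope.
Local Open Scope ring_scope.

Section Smoothness.
Context {R : realType}.

(* C^k on an open set O: all iterated directional derivatives up to order k
   exist on O, and those of order k are continuous there; for a finite
   dimensional V this is the usual notion. *)
Fixpoint Ck {V W : normedModType R} (O : set V) (k : nat) (F : V -> W) : Prop :=
  match k with
  | 0 => forall p, O p -> {for p, continuous F}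
  | k'.+1 => forall v : V,
      (forall p, O p -> derivable F p v) /\ Ck O k' (fun p => 'D_v F p)
  end.

(* Smoothness on an arbitrary subset A: restriction of a smooth map defined on
   an open neighbourhood of A.  It is used with A = [0, T] x M. *)
Definition smooth_on {V W : normedModType R} (A : set V) (F : V -> W) : Prop :=
  exists (O : set V) (G : V -> W),
    [/\ open O, A `<=` O, forall k, Ck O k G & forall p, A p -> F p = G p].

(* Time derivative relative to [0, T]: two-sided inside the interval, one-sided
   at 0 and at T, so that values outside [0, T] play no role. *)
Definition tderiv (T : R) {V : normedModType R} (F : R -> V) (t : R) : V :=
  lim ((fun s => (s - t)^-1 *: (F s - F t)) @ within `[0, T]%classic t^').

Definition tderivable (T : R) {V : normedModType R} (F : R -> V) (t : R) : Prop :=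
  cvg ((fun s => (s - t)^-1 *: (F s - F t)) @ within `[0, T]%classic t^').

Definition C1_curve (T : R) {V : normedModType R} (c : R -> V) : Prop :=
  (forall t, t \in `[0, T] -> tderivable T c t) /\
  {within `[0, T], continuous (tderiv T c)}.

End Smoothness.

(* Riemannian geometry in the global chart of an open subset of R^d.  Tangent
   vectors are row vectors; a metric is a field G of symmetric positive definite
   matrices, with inverse the matrix field of its cometric. *)
Section Geometry.
Context {R : realType} {d : nat}.
Local Notation vec := 'rV[R]_d.
Implicit Types (G : vec -> 'M[R]_d) (X Y : vec -> vec) (h : vec -> R).
Implicit Types (x v w : vec).

Definition basis (i : 'I_d) : vec := delta_mx 0 i.

(* X h, the field X acting on functions as a first order operator. *)
Definition vact X h : vec -> R := fun x => 'D_(X x) h x.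

Definition inner G x v w : R := (v *m G x *m w^T) 0 0.

(* The vector representing the linear form l for the scalar product A; see
   inner_sharp. *)
Definition sharp (A : 'M[R]_d) (l : vec -> R) : vec :=
  (\row_i l (basis i)) *m invmx A.

Lemma inner_sharp G x (l : vec -> R) v :
  G x \in unitmx -> (forall (a : R) v1 v2, l (a *: v1 + v2) = a * l v1 + l v2) ->
  inner G x (sharp (G x) l) v = l v.
Proof.
move=> Gu lin; rewrite /inner /sharp mulmxKV // mxE.
have l0 : l 0 = 0 by have := lin (- 1) 0 0; rewrite scaler0 addr0 mulN1r addNr.
rewrite [in RHS](row_sum_delta v).
under eq_bigr do rewrite !mxE mulrC.
elim/big_rec2 : _ => [|i s1 s2 _ ->]; first by rewrite l0.
by rewrite lin.
Qed.

(* Gamma(v, w) = v^i w^j Gamma_ij^k e_k, the Christoffel symbols of G: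
   <Gamma(v, w), u> = (D_v G(w, u) + D_w G(v, u) - D_u G(v, w)) / 2. *)
Definition christoffel G x v w : vec :=
  sharp (G x) (fun u =>
    2^-1 * ('D_v (fun y => inner G y w u) x
            + 'D_w (fun y => inner G y v u) x
            - 'D_u (fun y => inner G y v w) x)).

(* Levi-Civita covariant derivative at x of the field Y in the direction v. *)
Definition nabla G v Y x : vec := 'D_v Y x + christoffel G x v (Y x).

Definition grad G h x : vec := sharp (G x) (fun v => 'D_v h x).

Definition diverg G Y x : R := \sum_(i < d) nabla G (basis i) Y x 0 i.

Definition laplace_beltrami G h x : R := diverg G (grad G h) x.

(* R(e_i, e_j) e_k; coordinate fields commute, so there is no bracket term. *)
Definition riemann G (i j k : 'I_d) x : vec :=
  nabla G (basis i) (nabla G (basis j) (cst (basis k))) x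
  - nabla G (basis j) (nabla G (basis i) (cst (basis k))) x.

(* Ric(Y, Z) is the trace of X |-> R(X, Y) Z. *)
Definition ricci G (j k : 'I_d) x : R := \sum_(i < d) riemann G i j k x 0 i.

Definition scalar_curvature G x : R :=
  \sum_(j < d) \sum_(k < d) invmx (G x) j k * ricci G j k x.

(* <(nabla xi)^* v, v2> = <nabla_{v2} xi, v>. *)
Definition nabla_adj G (xi : vec -> vec) x v : vec :=
  sharp (G x) (fun v2 => inner G x (nabla G v2 xi x) v).

End Geometry.

Section OnsagerMachlup.
Context {R : realType} {d J : nat}.
Local Notation vec := 'rV[R]_d.
Local Notation tfield := (R -> vec -> vec).
Implicit Types (T : R) (M : set vec) (u z w phi : tfield).
Implicit Types (sigma : 'I_J -> tfield) (c : R -> vec).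

Definition domain M : Prop := [/\ open M, connected M & M !=set0].

Definition time_vector_field T M (X : tfield) : Prop :=
  smooth_on (`[0, T] `*` M) (fun p : R * vec => X p.1 p.2).

Definition spanning T M sigma : Prop :=
  forall t x, t \in `[0, T] -> M x -> row_full (\matrix_(r < J) sigma r t x).

Definition cometric sigma (t : R) (x : vec) : 'M[R]_d :=
  \sum_(r < J) (sigma r t x)^T *m sigma r t x.

Definition metric sigma (t : R) (x : vec) : 'M[R]_d := invmx (cometric sigma t x).

Definition metric_dot T sigma (t : R) (x : vec) : 'M[R]_d :=
  tderiv T (fun s => metric sigma s x) t.

(* <gdot^* v, v2> = gdot(v, v2). *)
Definition gdot_star T sigma (t : R) (x v : vec) : vec :=
  sharp (metric sigma t x) (fun v2 => inner (metric_dot T sigma t) x v v2).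

(* (1/2) sum_r sigma_r^2 + u = (1/2) Delta_g + z as differential operators. *)
Definition generator_drift T M u sigma z : Prop :=
  forall t (h : vec -> R) x, t \in `[0, T] -> smooth_on M h -> M x ->
    2^-1 * (\sum_(r < J) vact (sigma r t) (vact (sigma r t) h) x) + vact (u t) h x
    = 2^-1 * laplace_beltrami (metric sigma t) h x + vact (z t) h x.

Definition potential T sigma z (t : R) (x : vec) : R :=
  2^-1 * diverg (metric sigma t) (z t) x
  - 12^-1 * scalar_curvature (metric sigma t) x
  + 4^-1 * \tr (metric_dot T sigma t x *m invmx (metric sigma t x)).

Definition OM_lagrangian T sigma z (t : R) (x v : vec) : R :=
  2^-1 * inner (metric sigma t) x (v - z t x) (v - z t x)
  + potential T sigma z t x.

Definition OM_functional T sigma z c : R :=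
  \int[lebesgue_measure]_(t in `[0, T])
    OM_lagrangian T sigma z t (c t) (tderiv T c t).

Definition path_in T M c : Prop :=
  C1_curve T c /\ forall t, t \in `[0, T] -> M (c t).

Definition most_probable_path T M sigma z c : Prop :=
  path_in T M c /\
  forall c', path_in T M c' -> c' 0 = c 0 -> c' T = c T ->
    OM_functional T sigma z c <= OM_functional T sigma z c'.

(* c is an extremal of the functional for variations with fixed end points.  As
   M is open, c + e eta stays in M for small e. *)
Definition stationary_path T M sigma z c : Prop :=
  path_in T M c /\
  forall eta : R -> vec, C1_curve T eta -> eta 0 = 0 -> eta T = 0 ->
    is_derive (0 : R) (1 : R)
      (fun e : R => OM_functional T sigma z (fun t => c t + e *: eta t)) (0 : R).

(* Smooth curves t |-> phi_t in the diffeomorphism group of M: (t, x) |->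
   phi_t(x) and (t, x) |-> phi_t^-1(x) are both smooth on [0, T] x M. *)
Definition diffeo_curve T M phi : Prop :=
  exists psi : tfield,
    [/\ time_vector_field T M phi, time_vector_field T M psi &
        forall t x, t \in `[0, T] -> M x ->
          [/\ M (phi t x), M (psi t x),
              psi t (phi t x) = x & phi t (psi t x) = x]].

Definition most_probable_flow T M sigma z phi : Prop :=
  forall x, M x -> most_probable_path T M sigma z (fun t => phi t x).

Definition stationary_flow T M sigma z phi : Prop :=
  forall x, M x -> stationary_path T M sigma z (fun t => phi t x).

Definition solves_flow_equation T M sigma z phi : Prop :=
  exists w : tfield,
    [/\ time_vector_field T M w,
        forall t x, t \in `[0, T] -> M x ->
          tderiv T (fun s => phi s x) t = w t (phi t x) + z t (phi t x) &
        forall t x, t \in `[0, T] -> M x ->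
          tderiv T (fun s => w s x) t
          + nabla (metric sigma t) (w t x + z t x) (w t) x
          + gdot_star T sigma t x (w t x)
          + nabla_adj (metric sigma t) (z t) x (w t x)
          = grad (metric sigma t) (potential T sigma z t) x].

End OnsagerMachlup.

(* Main.v *)
(* The Onsager-Machlup functional is the action of the Lagrangian
   |v - z|^2 / 2 + f.  For a curve c, put q = c' - z(c) and p = g q (the momentum);
   the first variation in the direction eta is
     int p . eta' + (Dg(q, q) / 2 - p . Dz + Df) eta,
   and integrating p . eta' by parts, then testing with eta(t) = t (T - t) E(t)
   where E is the Euler-Lagrange expression, shows that c is stationary iff
   E = 0.  For c = phi(x), q is w(phi) with w = phi' o phi^-1 - z, so p' is the
   derivative of the covector g w along the flow of w + z.  In the combination
   nabla_{w+z} w + (nabla z)^* w the Christoffel symbols collapse, after lowering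
   the index, to D_{w+z} g(w, .) - Dg(w, w) / 2; hence E is minus the covector of
   the difference of the two sides of the equation for w. *)

(* An extremal of the action need not minimize it in general, for instance past a conjugate point;
   this is why the flow equation is matched with stationary flows, while minimality only implies it.
   All data live on [0, T] x M, with one-sided time derivatives at 0 and T, and smoothness is
   expressed through directional derivatives of an extension to an open set. Two difficulties
   follow: Frechet differentiability, hence linearity of a derivative in its direction and the chain
   rule, has to be recovered from continuous directional derivatives; and time derivatives of smooth
   data are computed on an extension, then read back on [0, T]. The variation c + e eta may leave M,
   so compactness of [0, T] supplies one range of e valid for all t. Since the flow is smooth up to
   t = 0 and t = T, so is the Euler-Lagrange expression E, and a multiple of E can take the place of
   cut-off functions as a test direction. Invertibility of phi_t transports E = 0 from the
   trajectories to every point of M and makes w smooth. *)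
From HB Require Import structures.
Require Import Defs.
From mathcomp Require Import all_boot all_order all_algebra.
From mathcomp Require Import all_classical all_reals all_analysis.
From mathcomp Require Import ring.
Import Order.TTheory GRing.Theory Num.Theory.
Import numFieldNormedType.Exports.
Set Implicit Arguments.
Unset Strict Implicit.
Unset Printing Implicit Defensive.
Local Open Scope classical_set_scope.
Local Open Scope ring_scope.

(** * Smooth functions and Frechet differentiability *)

Section Cle.
Context {R : realType} {V : normedModType R}.
Implicit Types (O : set V) (F G : V -> R) (p v : V) (n : nat).

(* Cumulative variant of [Ck]: a product rule at order n needs the factors at
   all lower orders. *)
Fixpoint Cle O n F : Prop :=
  (forall p, O p -> {for p, continuous F}) /\
  if n is n'.+1 then
    forall v, (forall p, O p -> derivable F p v) /\ Cle O n' (fun p => 'D_v F p)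
  else True.

Lemma Cle_cont O n F p : Cle O n F -> O p -> {for p, continuous F}.
Proof. by case: n => [|n] [cF _]; exact: cF. Qed.

Lemma CleW O n F : Cle O n.+1 F -> Cle O n F.
Proof.
elim: n F => [|n IH] F [cF DF]; first by [].
split=> // v; have [dF DvF] := DF v; split=> //; exact: IH.
Qed.

Lemma Cle_sub O O' n F : O' `<=` O -> Cle O n F -> Cle O' n F.
Proof.
move=> sO; elim: n F => [|n IH] F [cF DF]; split=> //; try by move=> p /sO/cF.
move=> v; have [dF DvF] := DF v; split; first by move=> p /sO/dF.
exact: IH.
Qed.

(** Only all orders together can be compared: [Ck] records continuity of a function at order 0
    alone, so each stage of the induction calls order 0 of the current derivative. *)
Lemma Cle_Ck O F : (forall n, Ck O n F) <-> (forall n, Cle O n F).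
Proof.
split=> H n.
  elim: n F H => [|n IH] F H /=.
    by split => //; exact: (H 0).
  split; first exact: (H 0).
  move=> v; split; first by have [] := H 1%N v.
  by apply: IH => k; have [] := H k.+1 v.
elim: n F H => [|n IH] F H /=; first exact: (H 0).1.
move=> v; have [dF _] := (H 1%N).2 v; split=> //.
by apply: IH => k; exact: ((H k.+1).2 v).2.
Qed.

Lemma near_open_eq O F G p : open O -> {in O, F =1 G} -> O p ->
  \forall q \near p, F q = G q.
Proof.
move=> oO FG Op; near=> q; apply: FG; rewrite inE.
by near: q; exact: open_nbhs_nbhs.
Unshelve. all: by end_near. Qed.

Lemma Cle_eq O n F G : open O -> {in O, F =1 G} -> Cle O n F -> Cle O n G.
Proof.
move=> oO; have cont F' G' : {in O, F' =1 G'} ->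
    (forall p, O p -> {for p, continuous F'}) ->
    forall p, O p -> {for p, continuous G'}.
  move=> FG cF p Op; rewrite /prop_for /continuous_at -FG ?inE//.
  apply: cvg_trans (cF p Op); apply: near_eq_cvg.
  exact: near_open_eq FG Op.
elim: n F G => [|n IH] F G FG [cF DF] /=; first by split=> //; exact: cont cF.
split; first exact: cont cF.
move=> v; have [dF DvF] := DF v; split=> [p Op|].
  apply: near_eq_derivable (dF p Op); exact: near_open_eq FG Op.
apply: IH DvF => p /[!inE] Op; apply: near_eq_derive; exact: near_open_eq FG Op.
Qed.

Lemma Cle_cst O n (a : R) : open O -> Cle O n (cst a).
Proof.
move=> oO; elim: n a => [|n IH] a /=; split=> //; try by move=> p _; exact: cvg_cst.
move=> v; split=> [p _|]; first exact: derivable_cst.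
by apply: Cle_eq (IH 0) => // p _; rewrite /= derive_cst.
Qed.

Lemma Cle_add O n F G : open O -> Cle O n F -> Cle O n G ->
  Cle O n (fun p => F p + G p).
Proof.
move=> oO; elim: n F G => [|n IH] F G [cF DF] [cG DG] /=.
  by split=> // p Op; apply: cvgD; [exact: cF|exact: cG].
split=> [p Op|v]; first by apply: cvgD; [exact: cF|exact: cG].
have [dF DvF] := DF v; have [dG DvG] := DG v.
split=> [p Op|]; first by apply: derivableD; [exact: dF|exact: dG].
apply: Cle_eq (IH _ _ DvF DvG) => // p /[!inE] Op.
by rewrite -deriveD//; [exact: dF|exact: dG].
Qed.

Lemma Cle_mul O n F G : open O -> Cle O n F -> Cle O n G ->
  Cle O n (fun p => F p * G p).
Proof.
move=> oO; elim: n F G => [|n IH] F G CF CG /=.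
  by split=> // p Op; apply: cvgM; [exact: CF.1|exact: CG.1].
have [cF DF] := CF; have [cG DG] := CG.
split=> [p Op|v]; first by apply: cvgM; [exact: cF|exact: cG].
have [dF DvF] := DF v; have [dG DvG] := DG v.
split=> [p Op|]; first by apply: derivableM; [exact: dF|exact: dG].
apply: Cle_eq (Cle_add oO (IH _ _ (CleW CF) DvG) (IH _ _ (CleW CG) DvF)) => //.
move=> p /[!inE] Op /=.
by rewrite [RHS]deriveM//; [exact: dF|exact: dG].
Qed.

Lemma Cle_inv O n F : open O -> (forall p, O p -> F p != 0) ->
  Cle O n F -> Cle O n (fun p => (F p)^-1).
Proof.
move=> oO F0; elim: n F F0 => [|n IH] F F0 CF /=.
  by split=> // p Op; apply: cvgV; [exact: F0|exact: CF.1].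
have [cF DF] := CF.
split=> [p Op|v]; first by apply: cvgV; [exact: F0|exact: cF].
have [dF DvF] := DF v.
split=> [p Op|]; first by apply: derivableV; [exact: F0|exact: dF].
(* The derivative -(1/F)^2 DF involves 1/F again, but only at the order n covered by the induction
   hypothesis. *)
have CI := IH _ F0 (CleW CF).
apply: Cle_eq (Cle_mul oO (Cle_cst n (- 1) oO)
  (Cle_mul oO (Cle_mul oO CI CI) DvF)) => //.
move=> p /[!inE] Op /=.
rewrite [RHS]deriveV ?F0//; last exact: dF.
by rewrite mulN1r /GRing.scale/= mulNr expr2 invfM.
Qed.

End Cle.

Section Frechet.
Context {R : realType}.

(** Mean value theorem on the segment between 0 and [a], with one case per sign of [a], since the
    coordinates of an increment have no fixed sign. The deviation of the slope from [L] is what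
    becomes the remainder of the differential. *)
Lemma increment_bound (g g' : R -> R) (L eps a : R) :
  (forall s : R, `|s| <= `|a| -> is_derive s (1 : R) g (g' s)) ->
  (forall s, `|s| <= `|a| -> `|g' s - L| <= eps) ->
  `|g a - g 0 - a * L| <= eps * `|a|.
Proof.
move=> dg bg.
have cont x y : (forall s, x <= s <= y -> `|s| <= `|a|) ->
    {within `[x, y], continuous g}.
  move=> xy; apply: derivable_within_continuous => s /[!in_itv]/= /xy sa.
  by have [] := dg _ sa.
have [a0|a0] := leP 0 a.
  have sa s : 0 <= s <= a -> `|s| <= `|a|.
    by move=> /andP[s0 sa]; rewrite !ger0_norm.
  have [|c ca ->] := @MVT_segment R g g' 0 a a0 _ (cont _ _ sa).
    move=> s /[!in_itv]/= /andP[s0 sa']; apply: dg; apply: sa.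
    by rewrite !ltW.
  rewrite subr0 mulrC -mulrBr normrM mulrC ler_wpM2r//; apply: bg; apply: sa.
  by rewrite in_itv/= in ca.
have sa s : a <= s <= 0 -> `|s| <= `|a|.
  by move=> /andP[sa s0]; rewrite !ler0_norm ?(ltW a0)// lerN2.
have [|c ca ga] := @MVT_segment R g g' a 0 (ltW a0) _ (cont _ _ sa).
  move=> s /[!in_itv]/= /andP[s0 sa']; apply: dg; apply: sa.
  by rewrite !ltW.
have -> : g a - g 0 = g' c * a by rewrite -opprB ga sub0r mulrN opprK.
rewrite mulrC -mulrBr normrM mulrC ler_wpM2r//; apply: bg; apply: sa.
by rewrite in_itv/= in ca.
Qed.

Lemma is_derive_line {V W : normedModType R} (F : V -> W) (q v : V) (s : R) :
  derivable F (s *: v + q) v ->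
  is_derive s (1 : R) (fun s : R => F (s *: v + q)) ('D_v F (s *: v + q)).
Proof.
have E : (fun h : R => h^-1 *: (((fun s => F (s *: v + q)) \o shift s) (h *: (1:R))
     - F (s *: v + q))) = (fun h => h^-1 *: ((F \o shift (s *: v + q)) (h *: v) - F (s *: v + q))).
  by apply/funext => h /=; rewrite [_%:A]mulr1 scalerDl addrA.
move=> dF; apply: DeriveDef.
  by rewrite /derivable E.
by rewrite /derive E.
Qed.

(* Uniformity in the base point [q] is what lets the increments along the [e i]
   be added one at a time, each by the mean value theorem. *)
Lemma strict_increments {V : normedModType R} (O : set V) (F : V -> R) (p : V)
    (e : nat -> V) (n : nat) (eps : R) : open O -> Cle O 1 F -> O p -> 0 < eps ->
  exists2 delta, 0 < delta & forall (q : V) (a : nat -> R), `|q - p| < delta ->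
    (forall i, `|a i| < delta) ->
    `|F (\sum_(i < n) a i *: e i + q) - F q - \sum_(i < n) a i * 'D_(e i) F p|
      <= eps * \sum_(i < n) `|a i|.
Proof.
move=> oO [cF DF] Op eps0; elim: n => [|n [d1 d10 IH]].
  exists 1 => // q a _ _.
  by rewrite !big_ord0 add0r subrr subr0 normr0 mulr0.
have [dF [cDF _]] := DF (e n).
have : \forall x \near p, O x /\ `|'D_(e n) F x - 'D_(e n) F p| <= eps.
  near=> x; split; first by near: x; exact: open_nbhs_nbhs.
  rewrite distrC; near: x; move/cvgrPdist_le : (cDF p Op); exact.
case/nbhs_normP => r /= r0 Hr.
(* With |q - p| and all |a i| below r / S, the intermediate points stay within (r / S) (1 + sum of
   the |e i|) = r of p; the summand 1 accounts for the distance from p to q. *)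
pose S := 1 + \sum_(i < n.+1) `|e i|.
have S0 : 0 < S by rewrite ltr_pwDl// sumr_ge0.
exists (Num.min d1 (r / S)); first by rewrite lt_min d10 divr_gt0.
move=> q a; rewrite lt_min => /andP[qd1 qr] ad.
have ad1 i : `|a i| < d1 by have := ad i; rewrite lt_min => /andP[].
have ar i : `|a i| < r / S by have := ad i; rewrite lt_min => /andP[].
pose q' := \sum_(i < n) a i *: e i + q.
have near_p s : `|s| <= `|a n| -> ball_ Num.norm p r (s *: e n + q').
  move=> sa; rewrite /ball_/= distrC /q'.
  have -> : s *: e n + (\sum_(i < n) a i *: e i + q) - p
      = (q - p) + (\sum_(i < n) a i *: e i + s *: e n).
    by rewrite (addrC _ q) addrCA addrAC (addrC (s *: _)).
  apply: (le_lt_trans (ler_normD _ _)).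
  have -> : r = r / S + r / S * \sum_(i < n.+1) `|e i|.
    by rewrite -{1}(mulr1 (r / S)) -mulrDr -/S divfK// gt_eqF.
  apply: ltr_leD => //; rewrite mulr_sumr big_ord_recr/=.
  apply: (le_trans (ler_normD _ _)); apply: lerD.
    apply: (le_trans (ler_norm_sum _ _ _)); apply: ler_sum => i _.
    by rewrite normrZ ler_wpM2r// ltW.
  by rewrite normrZ ler_wpM2r// (le_trans sa)// ltW.
rewrite !big_ord_recr/=.
have B2 := IH q a qd1 ad1; rewrite -/q' in B2.
have B1 : `|F (a n *: e n + q') - F q' - a n * 'D_(e n) F p| <= eps * `|a n|.
  have := @increment_bound (fun s => F (s *: e n + q'))
    (fun s => 'D_(e n) F (s *: e n + q')) ('D_(e n) F p) eps (a n).
  rewrite scale0r add0r; apply => s sa.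
    by apply: is_derive_line; apply: dF; exact: (Hr _ (near_p s sa)).1.
  exact: (Hr _ (near_p s sa)).2.
have -> : \sum_(i < n) a i *: e i + a n *: e n + q = a n *: e n + q'.
  by rewrite /q' addrA (addrC (a n *: _)).
rewrite mulrDr.
set x := F (_ + q') in B1 *; set y := F q' in B1 B2.
set s := \sum_(i < n) a i * _ in B2 *.
have -> : x - F q - (s + a n * 'D_(e n) F p) =
   (y - F q - s) + (x - y - a n * 'D_(e n) F p) by ring.
by apply: (le_trans (ler_normD _ _)); exact: lerD.
Unshelve. all: by end_near. Qed.

End Frechet.

Section FrechetTimeSpace.
Context {R : realType} {d : nat}.
Local Notation vec := 'rV[R]_d.

(** Candidate differential, with time slope [a] and space slopes [b i]. It is registered as a linear
    map because [diff_unique] identifies the differential among those. *)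
Definition lin_form (a : R) (b : 'I_d -> R) (h : R * vec) : R :=
  h.1 * a + \sum_i h.2 0 i * b i.

Lemma lin_form_is_linear a b : linear (lin_form a b : R * vec -> R).
Proof.
move=> k x y; rewrite /lin_form/= [LHS]addrC.
under eq_bigr do rewrite !mxE mulrDl.
rewrite big_split/= /GRing.scale/= mulrDr mulr_sumr mulrDl.
under eq_bigr do rewrite -mulrA.
by ring.
Qed.
HB.instance Definition _ a b :=
  GRing.isLinear.Build R (R * vec)%type R _ (lin_form a b) (lin_form_is_linear a b).

Lemma coord_le_norm (h : R * vec) i : `|h.2 0 i| <= `|h|.
Proof.
apply: (@le_trans _ _ `|h.2|); last by rewrite prod_normE/= le_max lexx orbT.
rewrite {2}/Num.norm/= mx_normrE.
exact: (le_bigmax _ (fun ij => `|h.2 ij.1 ij.2|) (0, i)).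
Qed.

(** The increment estimate at q = p, along the d + 1 basis vectors of R x R^d, is exactly the
    little-o condition. [Cle] speaks of one direction at a time, so linearity of ['D_h F p] in [h]
    has its source here. *)
Lemma C1_diff (O : set (R * vec)) (F : R * vec -> R) p :
  open O -> Cle O 1 F -> O p ->
  differentiable F p /\
  forall h : R * vec, 'D_h F p = h.1 * 'D_(1, 0) F p + \sum_i h.2 0 i * 'D_(0, Defs.basis i) F p.
Proof.
move=> oO CF Op.
pose A := lin_form ('D_(1, 0) F p) (fun i => 'D_(0, Defs.basis i) F p).
have cA : continuous A.
  move=> x; rewrite /continuous_at /A /lin_form.
  apply: cvgD; first by apply: cvgMl; exact: cvg_fst.
  apply: cvg_big => [|i _]; first exact: add_continuous.
  apply: cvgMl.
  by apply: (continuous_comp (f := snd) (g := fun v : vec => v 0 i) (cvg_snd) ); exact: coord_continuous.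
(* Directions and coefficients are indexed by nat, as [strict_increments] requires: index 0 is time,
   index i + 1 the i-th space coordinate, and beyond the range the value is 0. *)
pose e (k : nat) : R * vec := if k is k'.+1 then
  (0, if insub k' is Some i then Defs.basis i else 0) else (1, 0).
pose a (h : R * vec) (k : nat) : R :=  if k is k'.+1 then
  (if insub k' is Some i then h.2 0 i else 0) else h.1.
have FA : (F : R * vec -> R) \o shift p = (cst (F p) + (A : R * vec -> R)) +o_ (0 : R * vec) id.
  apply/eqaddoP => _/posnumP[eps].
  (* The remainder will be bounded by this constant times a sum of d + 1 coordinates, each at most
     |h|. *)
  have eps'0 : 0 < eps%:num / d.+1%:R by rewrite divr_gt0.
  have [del del0 H] := strict_increments e d.+1 oO CF Op eps'0.
  near=> h.
  have ah k : `|a h k| <= `|h|.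
    case: k => [|k] /=; first by rewrite prod_normE/= le_max lexx.
    by case: insubP => [i _ _|_]; rewrite ?normr0//; exact: coord_le_norm.
  have hdel : `|h| < del.
    by near: h; change (\forall x \near (0 : R * vec), `|x| < del); exact: nbhs0_lt.
  have := H p (a h); rewrite subrr normr0 => /(_ del0 (fun i => le_lt_trans (ah i) hdel)).
  rewrite big_ord_recl [X in _ - X]big_ord_recl/=.
  under eq_bigr => i _ do rewrite valK.
  under [X in _ - (_ + X)]eq_bigr => i _ do rewrite valK.
  have -> : h.1 *: (1, 0) + \sum_(i < d) h.2 0 i *: (0, Defs.basis i) = h :> R * vec.
    rewrite [RHS]surjective_pairing [h.2 in RHS]row_sum_delta.
    apply/pair_equal_spec; split => /=.
      rewrite (raddf_sum fst)/= big1 => [|i _]; last by rewrite /= scaler0.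
      by rewrite addr0 [LHS]mulr1.
    by rewrite (raddf_sum snd)/= scaler0 add0r.
  move=> H1; rewrite -[X in `|X|]/(F (h + p) - (F p + A h)) /A /lin_form opprD addrA.
  apply: (le_trans H1).
  rewrite -mulrA ler_wpM2l//.
  rewrite ler_pdivrMl//.
  apply: (@le_trans _ _ (\sum_(i < d.+1) `|h|)); first exact: ler_sum.
  by rewrite sumr_const card_ord mulr_natl.
have dE : 'd F p = A :> (R * vec -> R) by exact: diff_unique.
have dF : differentiable F p by apply/diff_locallyP; rewrite dE.
by split=> // h; rewrite deriveE// dE.
Unshelve. all: by end_near. Qed.

End FrechetTimeSpace.

(** * Closure properties of smoothness on a subset *)

Lemma cvg_mx {R : realType} {T : Type} {m n : nat} (Fi : set_system T)
    (f : T -> 'M[R]_(m, n)) (l : 'M[R]_(m, n)) : Filter Fi ->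
  (forall i j, f x i j @[x --> Fi] --> l i j) -> f x @[x --> Fi] --> l.
Proof.
move=> FF fl; apply/cvgrPdist_le => e e0; near=> x.
rewrite [leLHS]/Num.norm/= mx_normrE (bigmax_le _ (ltW e0))//= => i _.
rewrite !mxE; move: i; near: x; apply: filter_forall => i.
by have /cvgrPdist_le := fl i.1 i.2; exact.
Unshelve. all: by end_near. Qed.

Lemma continuous_comp_pair {U V W Y : topologicalType} (F : V * W -> Y)
    (a : U -> V) (b : U -> W) u :
  {for u, continuous a} -> {for u, continuous b} ->
  {for (a u, b u), continuous F} -> {for u, continuous (fun x => F (a x, b x))}.
Proof.
move=> ca cb cF.
exact: (@cvg_comp _ _ _ (fun x => (a x, b x)) F _ _ _ (cvg_pair ca cb) cF).
Qed.

Section SmoothOn.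
Context {R : realType} {V : normedModType R}.
Implicit Types (A O : set V) (F G : V -> R).

Lemma smooth_onP A F : smooth_on A F <-> exists (O : set V) (G : V -> R),
  [/\ open O, A `<=` O, forall n, Cle O n G & forall p, A p -> F p = G p].
Proof.
by split; case=> O [G [oO AO /Cle_Ck CG FG]]; exists O, G.
Qed.

Lemma smooth_on_eq A F G : (forall p, A p -> F p = G p) -> smooth_on A F ->
  smooth_on A G.
Proof.
move=> FG [ O [H [oO AO CH FH]]].
by exists O, H; split=> // p Ap; rewrite -FG// FH.
Qed.

Lemma smooth_on_cst A (a : R) : smooth_on A (fun=> a).
Proof.
apply/smooth_onP; exists setT, (cst a); split => //; first exact: openT.
by move=> n; apply: Cle_cst; exact: openT.
Qed.

Lemma smooth_onD A F G : smooth_on A F -> smooth_on A G ->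
  smooth_on A (fun p => F p + G p).
Proof.
move=> /smooth_onP[ O [F' [oO AO CF FF']]] /smooth_onP[ O' [G' [oO' AO' CG GG']]].
apply/smooth_onP; exists (O `&` O'), (fun p => F' p + G' p); split.
- exact: openI.
- by move=> p Ap; split; [exact: AO|exact: AO'].
- move=> n; apply: Cle_add; first exact: openI.
    by apply: Cle_sub (CF n) => p [].
  by apply: Cle_sub (CG n) => p [].
- by move=> p Ap; rewrite FF'// GG'.
Qed.

Lemma smooth_onM A F G : smooth_on A F -> smooth_on A G ->
  smooth_on A (fun p => F p * G p).
Proof.
move=> /smooth_onP[ O [F' [oO AO CF FF']]] /smooth_onP[ O' [G' [oO' AO' CG GG']]].
apply/smooth_onP; exists (O `&` O'), (fun p => F' p * G' p); split.
- exact: openI.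
- by move=> p Ap; split; [exact: AO|exact: AO'].
- move=> n; apply: Cle_mul; first exact: openI.
    by apply: Cle_sub (CF n) => p [].
  by apply: Cle_sub (CG n) => p [].
- by move=> p Ap; rewrite FF'// GG'.
Qed.

Lemma smooth_onN A F : smooth_on A F -> smooth_on A (fun p => - F p).
Proof.
move=> sF; apply: smooth_on_eq (smooth_onM (smooth_on_cst A (- 1)) sF) => p _.
by rewrite mulN1r.
Qed.

Lemma smooth_onV A F : (forall p, A p -> F p != 0) -> smooth_on A F ->
  smooth_on A (fun p => (F p)^-1).
Proof.
move=> F0 /smooth_onP[ O [F' [oO AO CF FF']]].
(* The extension may vanish off A, so its domain is cut down to the points where it does not. *)
have oO' : open (O `&` [set p | F' p != 0]).
  rewrite openE => p [Op F'p]; near=> q; split.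
    by near: q; exact: open_nbhs_nbhs.
  by near: q; apply: (cvgr_neq0 (F' p)) => //; exact: Cle_cont (CF 0) Op.
apply/smooth_onP; exists (O `&` [set p | F' p != 0]), (fun p => (F' p)^-1); split => //.
- by move=> p Ap; split; [exact: AO|rewrite /= -FF'// F0].
- move=> n; apply: Cle_inv => //; first by move=> p [].
  by apply: Cle_sub (CF n) => p [].
- by move=> p Ap; rewrite FF'.
Unshelve. all: by end_near. Qed.

Lemma smooth_on_sum A (I : Type) (r : seq I) (P : pred I) (F : I -> V -> R) :
  (forall i, smooth_on A (F i)) -> smooth_on A (fun p => \sum_(i <- r | P i) F i p).
Proof.
move=> sF; elim: r => [|i r IH].
  by apply: smooth_on_eq (smooth_on_cst A 0) => p _; rewrite big_nil.
have [Pi|Pi] := boolP (P i).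
  by apply: smooth_on_eq (smooth_onD (sF i) IH) => p _; rewrite big_cons Pi.
by apply: smooth_on_eq IH => p _; rewrite big_cons (negbTE Pi).
Qed.

Lemma smooth_on_prod A (I : Type) (r : seq I) (P : pred I) (F : I -> V -> R) :
  (forall i, smooth_on A (F i)) -> smooth_on A (fun p => \prod_(i <- r | P i) F i p).
Proof.
move=> sF; elim: r => [|i r IH].
  by apply: smooth_on_eq (smooth_on_cst A 1) => p _; rewrite big_nil.
have [Pi|Pi] := boolP (P i).
  by apply: smooth_on_eq (smooth_onM (sF i) IH) => p _; rewrite big_cons Pi.
by apply: smooth_on_eq IH => p _; rewrite big_cons (negbTE Pi).
Qed.

(** Finiteness of [I] keeps the intersection of the separate domains open. Functions that are to be
    multiplied or assembled into a matrix can then be differentiated on one open set. *)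
Lemma common_extension A (I : finType) (F : I -> V -> R) :
  (forall i, smooth_on A (F i)) -> exists (O : set V) (G : I -> V -> R),
  [/\ open O, A `<=` O, forall i n, Cle O n (G i) &
      forall i p, A p -> F i p = G i p].
Proof.
move=> sF.
have /choice[OG HOG] : forall i, exists OG : set V * (V -> R),
    [/\ open OG.1, A `<=` OG.1, forall n, Cle OG.1 n OG.2 &
     forall p, A p -> F i p = OG.2 p].
  by move=> i; have /smooth_onP[ O [G ?]] := sF i; exists (O, G).
exists (\big[setI/setT]_(i : I) (OG i).1), (fun i => (OG i).2); split.
- elim/big_ind : _ => [||i _]; first exact: openT.
    by move=> *; exact: openI.
  by have [] := HOG i.
- elim/big_ind : _ => [//|B C AB AC p Ap|i _].
    by split; [exact: AB|exact: AC].
  by have [] := HOG i.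
- move=> i n; have [_ _ CG _] := HOG i.
  by apply: Cle_sub (CG n); rewrite (bigD1 i)//= => p [].
- by move=> i p Ap; have [_ _ _ ->] := HOG i.
Qed.

(** Passage between matrix-valued [Ck] and the scalar [Cle] calculus. In the converse direction the
    entries come with different extensions, which [common_extension] brings to one open set. *)
Lemma smooth_on_mxP A m n (F : V -> 'M[R]_(m, n)) :
  smooth_on A F <-> forall i j, smooth_on A (fun p => F p i j).
Proof.
split=> [[ O [G [oO AO CG FG]]] i j|sF].
  apply/smooth_onP; exists O, (fun p => G p i j); split => //; last first.
    by move=> p /FG ->.
  move=> k; elim: k G CG {FG} => [|k IH] G CG; split=> //.
  - move=> p Op; apply: (continuous_comp (g := fun M : 'M[R]_(m, n) => M i j)).
      exact: (CG 0%N).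
    exact: coord_continuous.
  - move=> p Op; apply: (continuous_comp (g := fun M : 'M[R]_(m, n) => M i j)).
      exact: (CG 0%N).
    exact: coord_continuous.
  - move=> v; have [dG _] := CG 1%N v; split=> [p Op|].
      by have /derivable_mxP := dG p Op; exact.
    apply: (Cle_eq oO) (IH (fun p => 'D_v G p) _) => [p /[!inE] Op|l].
      by rewrite derive_mx ?mxE//; exact: dG.
    by have [] := CG l.+1 v.
have [ O [G [oO AO CG FG]]] := common_extension (fun ij => sF ij.1 ij.2).
exists O, (fun p => \matrix_(i, j) G (i, j) p); split => //; last first.
  by move=> p Ap; apply/matrixP => i j; rewrite mxE -FG.
pose H p := \matrix_(i, j) G (i, j) p.
have : forall i j k, Cle O k (fun p => H p i j).
  move=> i j k; apply: (Cle_eq oO) (CG (i, j) k) => p _; by rewrite mxE.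
rewrite -/H; move: H => H CH k; elim: k H CH => [|k IH] H CH /=.
  by move=> p Op; apply: cvg_mx => i j; exact: Cle_cont (CH i j 0%N) Op.
move=> v; have dH p : O p -> derivable H p v.
  move=> Op; apply/derivable_mxP => i j.
  by have [_ /(_ v)[dH _]] := CH i j 1%N; exact: dH.
split=> //; apply: IH => i j l.
have [_ /(_ v)[_]] := CH i j l.+1.
by apply: (Cle_eq oO) => p /[!inE] Op; rewrite derive_mx ?mxE//; exact: dH.
Qed.

Lemma smooth_on_mulmx A m n q (F : V -> 'M[R]_(m, n)) (G : V -> 'M[R]_(n, q)) :
  (forall i j, smooth_on A (fun p => F p i j)) ->
  (forall i j, smooth_on A (fun p => G p i j)) ->
  forall i j, smooth_on A (fun p => (F p *m G p) i j).
Proof.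
move=> sF sG i j.
apply: (smooth_on_eq (F := fun p => \sum_k F p i k * G p k j)).
  by move=> p _; rewrite mxE.
by apply: smooth_on_sum => k; exact: smooth_onM.
Qed.

Lemma smooth_on_det A n (F : V -> 'M[R]_n) :
  (forall i j, smooth_on A (fun p => F p i j)) -> smooth_on A (fun p => \det (F p)).
Proof.
move=> sF; apply: smooth_on_sum => s; apply: smooth_onM; first exact: smooth_on_cst.
exact: smooth_on_prod.
Qed.

(** Cramer's formula: the entries of the inverse are cofactors divided by the determinant, hence
    polynomials in the entries times the inverse of a nonvanishing smooth function. *)
Lemma smooth_on_invmx A n (F : V -> 'M[R]_n) :
  (forall p, A p -> F p \in unitmx) ->
  (forall i j, smooth_on A (fun p => F p i j)) ->
  forall i j, smooth_on A (fun p => invmx (F p) i j).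
Proof.
move=> uF sF i j.
apply: (smooth_on_eq (F := fun p => (\det (F p))^-1 * cofactor (F p) j i)).
  by move=> p Ap; rewrite /invmx uF// !mxE.
apply: smooth_onM.
  apply: smooth_onV; last exact: smooth_on_det.
  by move=> p /uF; rewrite unitmxE unitfE.
rewrite /cofactor; apply: smooth_onM; first exact: smooth_on_cst.
apply: smooth_on_det => k l.
by apply: smooth_on_eq (sF (lift j k) (lift i l)) => p _; rewrite !mxE.
Qed.

End SmoothOn.

(** * Chain rule and composition of smooth maps *)

Section DeriveComp.
Context {R : numFieldType}.

Lemma derive_along_line {U W : normedModType R} (F : U -> W) u v :
  'D_v F u = 'D_1 (fun s : R => F (s *: v + u)) 0.
Proof.
rewrite /derive; set f := fun h => _; set g := fun h => _.
suff -> : f = g by [].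
by apply/funext => h; rewrite /f /g/= addr0 [_%:A]mulr1 scale0r add0r.
Qed.

(** The inner map is derivable in the single direction [v]. Restricted to the line through [u] it
    becomes a function of one real variable, for which derivability is differentiability, so the
    chain rule for differentials applies. *)
Lemma is_derive_comp {U V W : normedModType R} (F : V -> W) (k : U -> V) u v :
  differentiable F (k u) -> derivable k u v ->
  is_derive u v (F \o k) ('D_('D_v k u) F (k u)).
Proof.
move=> dF dk.
pose K (s : R) := k (s *: v + u).
have K0 : K 0 = k u by rewrite /K scale0r add0r.
have dK : differentiable K 0.
  by apply/derivable1_diffP; exact: (derivable1P k u v).1.
have dF0 : differentiable F (K 0) by rewrite K0.
have dFK : differentiable (F \o K) 0 by exact: differentiable_comp.
apply: DeriveDef.
  by apply: (derivable1P _ u v).2; exact/derivable1_diffP.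
rewrite derive_along_line -[LHS]/('D_1 (F \o K) 0) deriveE//.
rewrite diff_comp// -[LHS]/('d F (K 0) ('d K 0 1)) -(deriveE _ dK) -(deriveE _ dF0).
by rewrite K0 (derive_along_line k).
Qed.

Lemma is_derive_pair {U V W : normedModType R} (a : U -> V) (b : U -> W) u v :
  derivable a u v -> derivable b u v ->
  is_derive u v (fun x => (a x, b x)) ('D_v a u, 'D_v b u).
Proof.
move=> da db.
have H : h^-1 *: ((a (h *: v + u), b (h *: v + u)) - (a u, b u)) @[h --> 0^']
    --> ('D_v a u, 'D_v b u) by exact: cvg_pair da db.
by apply: DeriveDef; [apply/cvg_ex; eexists; exact: H|exact: cvg_lim H].
Qed.

End DeriveComp.

Section Chain.
Context {R : realType} {d : nat}.
Local Notation vec := 'rV[R]_d.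

Lemma is_derive_chain {U : normedModType R} (O : set (R * vec))
    (F : R * vec -> R) (a : U -> R) (b : U -> vec) u v :
  open O -> Cle O 1 F -> O (a u, b u) ->
  derivable a u v -> derivable b u v ->
  is_derive u v (fun x => F (a x, b x)) ('D_('D_v a u, 'D_v b u) F (a u, b u)).
Proof.
move=> oO CF Ou da db.
have [dF _] := C1_diff oO CF Ou.
have [dab <-] := is_derive_pair da db.
exact: (is_derive_comp (k := fun x => (a x, b x))).
Qed.

Lemma derive_pair_split (O : set (R * vec)) (F : R * vec -> R) p (a : R) (b : vec) :
  open O -> Cle O 1 F -> O p ->
  'D_(a, b) F p = a * 'D_(1, 0) F p + 'D_(0, b) F p.
Proof.
move=> oO CF Op; have [_ E] := C1_diff oO CF Op.
by rewrite (E (a, b)) (E (0, b))/= mul0r add0r.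
Qed.

(** Induction on the order with [F] varying: the derivative of the composite is a sum of products of
    derivatives of [a] and [b] with partial derivatives of [F] composed with the same inner map, and
    the latter fall under the induction hypothesis. *)
Lemma Cle_comp {U : normedModType R} (O : set U) (O2 : set (R * vec))
    (F : R * vec -> R) (a : U -> R) (b : U -> vec) : open O -> open O2 ->
  (forall n, Cle O2 n F) -> (forall n, Cle O n a) ->
  (forall i n, Cle O n (fun x => b x 0 i)) ->
  (forall x, O x -> O2 (a x, b x)) ->
  forall n, Cle O n (fun x => F (a x, b x)).
Proof.
move=> oO oO2 CF Ca Cb OO2.
have db x v : O x -> derivable b x v.
  move=> Ox; apply/derivable_mxP => i j; rewrite ord1.
  by have [_ /(_ v)[+ _]] := Cb j 1%N; exact.
have da x v : O x -> derivable a x v.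
  by move=> Ox; have [_ /(_ v)[+ _]] := Ca 1%N; exact.
have cb x : O x -> {for x, continuous b}.
  move=> Ox; apply: cvg_mx => i j; rewrite ord1; exact: Cle_cont (Cb j 0%N) Ox.
have cont F' : (forall n, Cle O2 n F') -> forall x, O x ->
    {for x, continuous (fun x => F' (a x, b x))}.
  move=> CF' x Ox; apply: continuous_comp_pair; [exact: Cle_cont (Ca 0%N) Ox|exact: cb|].
  exact: Cle_cont (CF' 0%N) (OO2 _ Ox).
move=> n; elim: n F CF => [|n IH] F CF.
  by split=> //; exact: cont.
split=> [|v]; first exact: cont.
split=> [x Ox|].
  by have [] := is_derive_chain oO2 (CF 1%N) (OO2 _ Ox) (da _ v Ox) (db _ v Ox).
have CD w m : Cle O2 m (fun x => 'D_w F x) by have [_ /(_ w)[_]] := CF m.+1.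
have CK w := IH _ (CD w).
pose D x := 'D_v a x * 'D_(1, 0) F (a x, b x)
   + \sum_i 'D_v (fun y => b y 0 i) x * 'D_(0, Defs.basis i) F (a x, b x).
have Csum (r : seq 'I_d) : Cle O n (fun x => \sum_(i <- r)
    'D_v (fun y => b y 0 i) x * 'D_(0, Defs.basis i) F (a x, b x)).
  elim: r => [|i r IHr].
    by apply: Cle_eq (Cle_cst n 0 oO) => // x _; rewrite /= big_nil.
  have [_ /(_ v)[_ CDb]] := Cb i n.+1.
  apply: Cle_eq (Cle_add oO (Cle_mul oO CDb (CK (0, Defs.basis i))) IHr) => // x _.
  by rewrite /= big_cons.
apply: (Cle_eq oO (F := D)); last first.
  apply: (Cle_add oO _ (Csum (index_enum _))).
  have [_ /(_ v)[_ CDa]] := Ca n.+1.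
  exact: Cle_mul oO CDa (CK (1, 0)).
move=> x /[!inE] Ox.
have [_ ->] := is_derive_chain oO2 (CF 1%N) (OO2 _ Ox) (da _ v Ox) (db _ v Ox).
have [_ ->] := C1_diff oO2 (CF 1%N) (OO2 _ Ox); rewrite /D/=; congr (_ + _).
by apply: eq_bigr => i _; rewrite derive_mx ?mxE//; exact: db.
Qed.

(** Outside A the extended inner maps may leave the domain [O2] of the outer one, so the preimage of
    [O2], open by continuity, is intersected with their domains. The extensions themselves are
    returned because [tderiv_flow] differentiates them. *)
Lemma comp_extension {U : normedModType R} (A : set U) (O2 : set (R * vec))
    (F : R * vec -> R) (a : U -> R) (b : 'I_d -> U -> R) : open O2 ->
  (forall n, Cle O2 n F) -> smooth_on A a -> (forall i, smooth_on A (b i)) ->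
  (forall x, A x -> O2 (a x, \row_i b i x)) ->
  exists (O : set U) (a' : U -> R) (b' : U -> vec),
  [/\ open O /\ A `<=` O, forall x, O x -> O2 (a' x, b' x),
      (forall n, Cle O n a') /\ (forall i n, Cle O n (fun x => b' x 0 i)),
      forall n, Cle O n (fun x => F (a' x, b' x))
      & forall x, A x -> a x = a' x /\ \row_i b i x = b' x].
Proof.
move=> oO2 CF sa sb AO2.
have [ O1 [a' [oO1 AO1 Ca aa']]] := (smooth_onP _ _).1 sa.
have [ O3 [b' [oO3 AO3 Cb bb']]] := common_extension sb.
pose B x : vec := \row_i b' i x.
have CB i n : Cle O3 n (fun x => B x 0 i).
  by apply: (Cle_eq oO3 _ (Cb i n)) => x _; rewrite mxE.
pose O := (O1 `&` O3) `&` [set x | O2 (a' x, B x)].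
have oO : open O.
  rewrite openE => x [[x1 x3] x2].
  have cB : {for x, continuous B}.
    by apply: cvg_mx => i j; rewrite ord1; exact: Cle_cont (CB j 0%N) x3.
  have cK : {for x, continuous (fun y => (a' y, B y))}.
    exact: cvg_pair (Cle_cont (Ca 0%N) x1) cB.
  have nO2 : nbhs (a' x, B x) O2 by exact: open_nbhs_nbhs.
  near=> y; split; first (split; near: y; exact: open_nbhs_nbhs).
  by near: y; exact: cK nO2.
exists O, a', B; split.
- split=> // x Ax; split; first by split; [exact: AO1|exact: AO3].
  rewrite /= -aa'// /B; under eq_mx => i j do rewrite -bb'//.
  exact: AO2.
- by move=> x [].
- split=> [n|i n]; first by apply: Cle_sub (Ca n) => x [[]].
  by apply: Cle_sub (CB i n) => x [[]].
- apply: (Cle_comp oO oO2 CF) => [n|i n|x []//].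
    by apply: Cle_sub (Ca n) => x [[]].
  by apply: Cle_sub (CB i n) => x [[]].
- move=> x Ax; split; first exact: aa'.
  by apply/rowP => i; rewrite !mxE bb'.
Unshelve. all: by end_near. Qed.

Lemma smooth_on_comp {U : normedModType R} (A : set U) (B : set (R * vec))
    (F : R * vec -> R) (a : U -> R) (b : U -> vec) :
  smooth_on B F -> smooth_on A a -> (forall i, smooth_on A (fun x => b x 0 i)) ->
  (forall x, A x -> B (a x, b x)) -> smooth_on A (fun x => F (a x, b x)).
Proof.
move=> /smooth_onP[ O2 [F' [oO2 BO2 CF FF']]] sa sb AB.
have E x : \row_i b x 0 i = b x by apply/rowP => i; rewrite mxE.
have [|O [a' [b' [[oO AO] _ _ CFK ab]]]] := comp_extension oO2 CF sa sb.
  by move=> x Ax; rewrite E; exact/BO2/AB.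
apply/smooth_onP; exists O, (fun x => F' (a' x, b' x)); split => // x Ax.
by have [<- <-] := ab x Ax; rewrite E FF'//; exact: AB.
Qed.

End Chain.

(** * Time derivatives on [0, T] *)

Section TimeDerivative.
Context {R : realType} (T : R).
Hypothesis T_gt0 : 0 < T.

(** Properness makes the limit in [tderiv] unique. As T > 0, every ball around t contains another
    point of [0, T]: one on the right if t < T, one on the left if t = T. *)
Lemma within_dnbhs_proper t : t \in `[0, T] ->
  ProperFilter (within `[0, T]%classic t^').
Proof.
move=> /[!in_itv]/= /andP[t0 tT].
have FF : Filter (within `[0, T]%classic t^') by exact: within_filter.
apply: Build_ProperFilter_ex => P.
rewrite /within/= => -[r /= r0 H].
have [tltT|Tlet] := ltP t T.
  have m0 : 0 < Num.min (r / 2) (T - t) by rewrite lt_min divr_gt0//= subr_gt0.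
  exists (t + Num.min (r / 2) (T - t)); apply: H => /=.
  - rewrite opprD addrA subrr sub0r normrN gtr0_norm// gt_min.
    by rewrite ltr_pdivrMr// ltr_pMr// ltr1n.
  - by rewrite -subr_eq0 addrC addKr gt_eqF.
  - rewrite in_itv/= addr_ge0 ?(ltW m0)//= -lerBrDl ge_min lexx orbT//.
have tE : t = T by apply/eqP; rewrite eq_le tT Tlet.
have m0 : 0 < Num.min (r / 2) T by rewrite lt_min divr_gt0.
exists (t - Num.min (r / 2) T); apply: H => /=.
- rewrite opprB addrC subrK gtr0_norm// gt_min.
  by rewrite ltr_pdivrMr// ltr_pMr// ltr1n.
- by rewrite -subr_eq0 addrC addKr oppr_eq0 gt_eqF.
- by rewrite in_itv/= subr_ge0 tE ge_min lexx orbT/= gerBl ltW.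
Qed.

Section Normed.
Context {V : normedModType R}.
Implicit Types (f g : R -> V) (t : R).

Lemma tderiv_cvg f t l : t \in `[0, T] ->
  (s - t)^-1 *: (f s - f t) @[s --> within `[0, T]%classic t^'] --> l ->
  tderivable T f t /\ tderiv T f t = l.
Proof.
move=> tT fl; have PF := within_dnbhs_proper tT.
by split; [apply/cvg_ex; exists l|exact: cvg_lim fl].
Qed.

Lemma tderivable_cvg f t : tderivable T f t ->
  (s - t)^-1 *: (f s - f t) @[s --> within `[0, T]%classic t^'] --> tderiv T f t.
Proof. by []. Qed.

Lemma tderivD f g t : t \in `[0, T] -> tderivable T f t -> tderivable T g t ->
  tderivable T (fun s => f s + g s) t /\
  tderiv T (fun s => f s + g s) t = tderiv T f t + tderiv T g t.
Proof.
move=> tT /tderivable_cvg df /tderivable_cvg dg; apply: tderiv_cvg => //.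
apply: cvg_trans (cvgD df dg); apply: near_eq_cvg; near=> s => /=.
by rewrite fctE -scalerDr opprD addrACA.
Unshelve. all: by end_near. Qed.

Lemma tderivZ f (a : R) t : t \in `[0, T] -> tderivable T f t ->
  tderivable T (fun s => a *: f s) t /\
  tderiv T (fun s => a *: f s) t = a *: tderiv T f t.
Proof.
move=> tT /tderivable_cvg df; apply: tderiv_cvg => //.
have H : a *: ((s - t)^-1 *: (f s - f t)) @[s --> within `[0, T]%classic t^']
    --> a *: tderiv T f t by exact: cvgZl_tmp df.
apply: cvg_trans H; apply: near_eq_cvg; near=> s => /=.
by rewrite -scalerBr !scalerA mulrC.
Unshelve. all: by end_near. Qed.

Lemma eq_tderiv f g t : t \in `[0, T] -> (forall s, s \in `[0, T] -> f s = g s) ->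
  tderiv T f t = tderiv T g t.
Proof.
move=> tT fg; rewrite /tderiv; congr (lim _).
rewrite eqEsubset; split; apply: near_eq_cvg; rewrite near_withinE; near=> s => sT;
  by rewrite !fg.
Unshelve. all: by end_near. Qed.

Lemma eq_tderivable f g t : t \in `[0, T] -> (forall s, s \in `[0, T] -> f s = g s) ->
  tderivable T f t -> tderivable T g t.
Proof.
move=> tT fg /cvg_ex[l fl]; apply/cvg_ex; exists l; apply: cvg_trans fl.
by apply: near_eq_cvg; rewrite near_withinE; near=> s => sT; rewrite !fg.
Unshelve. all: by end_near. Qed.

Lemma cvg_subr_dnbhs t : (s - t) @[s --> t^'] --> (0 : R)^'.
Proof.
move=> P [r /= r0 H]; exists r => //= s st snt; apply: H => /=.
  by rewrite sub0r opprB.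
by rewrite subr_eq0.
Qed.

Lemma cvg_addr_dnbhs t : (h + t) @[h --> (0 : R)^'] --> t^'.
Proof.
move=> P [r /= r0 H]; exists r => //= s /=; rewrite sub0r normrN => sr s0; apply: H => /=.
  by rewrite opprD addrC subrK normrN.
by rewrite -subr_eq0 addrK.
Qed.

(** The difference quotients of an extension converge over the whole punctured neighbourhood, hence
    over its trace on [0, T]. This is the bridge from ordinary calculus to the one-sided derivatives
    at 0 and T. *)
Lemma tderiv_extend f g t : t \in `[0, T] ->
  (forall s, s \in `[0, T] -> f s = g s) -> derivable g t 1 ->
  tderivable T f t /\ tderiv T f t = 'D_1 g t.
Proof.
move=> tT fg dg; rewrite (eq_tderiv tT fg).
suff [? ?] : tderivable T g t /\ tderiv T g t = 'D_1 g t.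
  split=> //; apply: (@eq_tderivable g) => // s sT; by rewrite fg.
apply: tderiv_cvg => //.
have {}dg : h^-1 *: (g (h *: 1 + t) - g t) @[h --> (0 : R)^'] --> 'D_1 g t by [].
have := cvg_comp _ _ (@cvg_subr_dnbhs t) dg.
rewrite [X in X @ _ --> _](_ : _ = fun s => (s - t)^-1 *: (g s - g t)).
  exact: cvg_within_filter.
by apply/funext => s /=; rewrite [_%:A]mulr1 subrK.
Qed.

Lemma tderiv_interior f t : t \in `]0, T[ -> tderivable T f t ->
  is_derive t 1 f (tderiv T f t).
Proof.
move=> tT /tderivable_cvg df.
have dE : h^-1 *: (f (h *: 1 + t) - f t) @[h --> (0 : R)^'] --> tderiv T f t.
  have E : t^' --> within `[0, T]%classic t^'.
    move=> P; rewrite /within/= => HP.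
    have : \forall s \near t^', s \in `]0, T[.
      by apply: nbhs_dnbhs; exact: near_in_itvoo.
    move=> H; near=> s.
    have : s \in `]0, T[ by near: s.
    have : s \in `[0, T] -> P s by near: s.
    move=> + sT; apply; exact: subset_itv_oo_cc sT.
  have := cvg_comp _ _ (cvg_trans (@cvg_addr_dnbhs t) E) df.
  rewrite [X in X @ _ --> _](_ : _ = fun h : R => h^-1 *: (f (h *: 1 + t) - f t))//.
  by apply/funext => s /=; rewrite [_%:A]mulr1 addrK.
by apply: DeriveDef; [apply/cvg_ex; eexists; exact: dE|exact: cvg_lim dE].
Unshelve. all: by end_near. Qed.

Lemma tderivable_continuous f : (forall t, t \in `[0, T] -> tderivable T f t) ->
  {within `[0, T], continuous f}.
Proof.
move=> df; apply/subspace_continuousP => t tT.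
have {}tT : t \in `[0, T] by [].
have := tderivable_cvg (df t tT); set l := tderiv T f t => fl.
have id0 : (s - t) @[s --> within `[0, T]%classic t^'] --> (0 : R).
  by apply: cvg_within_filter; apply: cvg_trans (@cvg_subr_dnbhs t) _; exact: cvg_within.
have FF : Filter (within `[0, T]%classic t^') by exact: within_filter.
(* The increment f s - f t is (s - t) times the difference quotient, a null factor times a
   convergent one. *)
have := cvgZ id0 fl; rewrite scale0r => /(_ FF) H.
have {}H : f s @[s --> within `[0, T]%classic t^'] --> f t.
  have H' : (s - t) *: ((s - t)^-1 *: (f s - f t)) + f t
      @[s --> within `[0, T]%classic t^'] --> f t.
    by rewrite -[X in _ --> X]add0r; apply: cvgD => //; exact: cvg_cst.
  apply: cvg_trans H'; apply: near_eq_cvg; rewrite near_withinE; near=> s => sT.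
  have st : s != t by near: s; exact: nbhs_dnbhs_neq.
  by rewrite scalerA divff ?subr_eq0// scale1r subrK.
move=> P nP.
have HP : \forall s \near t, s != t -> s \in `[0, T] -> P (f s) by exact: H P nP.
suff : \forall s \near t, s \in `[0, T] -> P (f s) by [].
apply: filterS HP => s Hs sT.
have [->|st] := eqVneq s t; first exact: nbhs_singleton.
exact: Hs.
Unshelve. all: by end_near. Qed.

Lemma C1_curve_cont f : C1_curve T f -> {within `[0, T], continuous f}.
Proof. by move=> [df _]; exact: tderivable_continuous. Qed.

End Normed.

Lemma tderiv_id t : t \in `[0, T] -> tderiv T (fun s => s) t = 1.
Proof.
move=> tT; apply: (tderiv_cvg tT _).2.
apply: cvg_trans (@cvg_cst _ (1 : R) _ (within `[0, T]%classic t^') _).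
apply: near_eq_cvg; rewrite near_withinE; near=> s => sT.
have st : s != t by near: s; exact: nbhs_dnbhs_neq.
by rewrite /cst/= [_ *: _]mulVf// subr_eq0.
Unshelve. all: by end_near. Qed.

Lemma tderiv_mx m n (f : R -> 'M[R]_(m, n)) t : t \in `[0, T] ->
  (forall i j, tderivable T (fun s => f s i j) t) ->
  tderivable T f t.
Proof.
move=> tT df; have PF := within_dnbhs_proper tT.
apply: (tderiv_cvg (l := \matrix_(i, j) tderiv T (fun s => f s i j) t) tT _).1.
apply: cvg_mx => i j; rewrite mxE.
suff -> : (fun s => ((s - t)^-1 *: (f s - f t)) i j) =
    (fun s => (s - t)^-1 *: (f s i j - f t i j)) by exact: tderivable_cvg (df i j).
by apply/funext => s; rewrite !mxE.
Qed.

Lemma tderiv_coord m n (f : R -> 'M[R]_(m, n)) t i j : t \in `[0, T] ->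
  tderivable T f t -> tderivable T (fun s => f s i j) t /\
  tderiv T (fun s => f s i j) t = tderiv T f t i j.
Proof.
move=> tT df; apply: tderiv_cvg => //.
suff -> : (fun s => (s - t)^-1 *: (f s i j - f t i j)) =
    (fun s => ((s - t)^-1 *: (f s - f t)) i j).
  exact: cvg_comp _ _ (tderivable_cvg df) (@coord_continuous R m n i j _).
by apply/funext => s; rewrite !mxE.
Qed.

Lemma within_continuous_coord (A : set R) m n (f : R -> 'M[R]_(m, n)) :
  {within A, continuous f} <-> forall i j, {within A, continuous (fun s => f s i j)}.
Proof.
split=> [/subspace_continuousP cf i j|cf]; apply/subspace_continuousP => t At.
  exact: cvg_comp (cf t At) (@coord_continuous R m n i j _).
by apply: cvg_mx => i j; have /subspace_continuousP := cf i j; exact.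
Qed.

Lemma eq_within_continuous (A : set R) (V : normedModType R) (f g : R -> V) :
  (forall s, A s -> f s = g s) ->
  {within A, continuous f} -> {within A, continuous g}.
Proof. by move=> fg; apply: subspace_eq_continuous => s /[!inE]; exact: fg. Qed.

Lemma C1_curve_mxP m n (f : R -> 'M[R]_(m, n)) :
  C1_curve T f <-> forall i j, C1_curve T (fun s => f s i j).
Proof.
split=> [[df cf] i j|Hf].
  split=> [t tT|]; first by have [] := tderiv_coord i j tT (df t tT).
  apply: eq_within_continuous ((within_continuous_coord _ _).1 cf i j) => s sT.
  by have [_ ->] := tderiv_coord i j sT (df s sT).
have df t : t \in `[0, T] -> tderivable T f t.
  by move=> tT; apply: tderiv_mx => // i j; exact: (Hf i j).1.
split=> //; apply/within_continuous_coord => i j.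
apply: eq_within_continuous (Hf i j).2 => s sT.
by have [_ ->] := tderiv_coord i j sT (df s sT).
Qed.

End TimeDerivative.

(** * Derivatives along time and space slices, and along a flow *)

Section Slices.
Context {R : realType} {d : nat} (T : R) (M : set 'rV[R]_d).
Hypotheses (T_gt0 : 0 < T) (oM : open M).
Local Notation vec := 'rV[R]_d.
Local Notation A := (`[0, T] `*` M).
Implicit Types (F : R * vec -> R) (O : set (R * vec)).

(** With t fixed, F and its extension G agree near x because M is open, so even at t = 0 and t = T
    the space derivatives are those of G in the directions (0, v). [slice_time] is the counterpart
    for (1, 0). *)
Lemma slice_space F O G t x v : open O -> A `<=` O -> (forall n, Cle O n G) ->
  (forall p, A p -> F p = G p) -> t \in `[0, T] -> M x ->
  is_derive x v (fun y => F (t, y)) ('D_(0, v) G (t, x)).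
Proof.
move=> oO AO CG FG tT Mx.
have Otx : O (t, x) by apply: AO.
have [_ /(_ (0, v))[dG _]] := CG 1%N.
have dGx := dG _ Otx.
apply: (@near_eq_is_derive _ _ _ (fun y => G (t, y))).
  near=> y; rewrite FG//; split=> //=; near: y; exact: open_nbhs_nbhs.
have E : (fun h : R => h^-1 *: (((fun y => G (t, y)) \o shift x) (h *: v) - G (t, x)))
   = (fun h => h^-1 *: ((G \o shift (t, x)) (h *: (0, v)) - G (t, x))).
  apply/funext => h /=; congr (_ *: (G _ - _)).
  by apply/pair_equal_spec; rewrite /= scaler0 add0r.
apply: DeriveDef; first by rewrite /derivable E.
by rewrite /derive E.
Unshelve. all: by end_near. Qed.

Lemma slice_time F O G t x : open O -> A `<=` O -> (forall n, Cle O n G) ->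
  (forall p, A p -> F p = G p) -> t \in `[0, T] -> M x ->
  tderivable T (fun s => F (s, x)) t /\
  tderiv T (fun s => F (s, x)) t = 'D_(1, 0) G (t, x).
Proof.
move=> oO AO CG FG tT Mx.
have Otx : O (t, x) by apply: AO.
have [_ /(_ (1, 0))[dG _]] := CG 1%N.
have dGx := dG _ Otx.
have E : (fun h : R => h^-1 *: (((fun s => G (s, x)) \o shift t) (h *: (1 : R)) - G (t, x)))
   = (fun h => h^-1 *: ((G \o shift (t, x)) (h *: (1, 0)) - G (t, x))).
  apply/funext => h /=; congr (_ *: (G _ - _)).
  by apply/pair_equal_spec; rewrite /= scaler0 add0r.
have -> : 'D_(1, 0) G (t, x) = 'D_1 (fun s => G (s, x)) t by rewrite /derive E.
apply: (tderiv_extend T_gt0 tT); last by rewrite /derivable E; exact: dGx.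
by move=> s sT; rewrite FG.
Qed.

Lemma smooth_tderivable F t x : smooth_on A F -> t \in `[0, T] -> M x ->
  tderivable T (fun s => F (s, x)) t.
Proof.
move=> /smooth_onP[ O [G [oO AO CG FG]]] tT Mx.
by have [] := slice_time oO AO CG FG tT Mx.
Qed.

Lemma smooth_derivable F t x v : smooth_on A F -> t \in `[0, T] -> M x ->
  derivable (fun y => F (t, y)) x v.
Proof.
move=> /smooth_onP[ O [G [oO AO CG FG]]] tT Mx.
by have [] := slice_space v oO AO CG FG tT Mx.
Qed.

Lemma smooth_derive_coord F t x v : smooth_on A F -> t \in `[0, T] -> M x ->
  'D_v (fun y => F (t, y)) x =
  \sum_i v 0 i * 'D_(Defs.basis i) (fun y => F (t, y)) x.
Proof.
move=> /smooth_onP[ O [G [oO AO CG FG]]] tT Mx.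
have [_ ->] := slice_space v oO AO CG FG tT Mx.
have [|_ ->] := C1_diff (p := (t, x)) oO (CG 1%N); first by apply: AO.
rewrite mul0r add0r; apply: eq_bigr => i _.
by have [_ ->] := slice_space (Defs.basis i) oO AO CG FG tT Mx.
Qed.

Lemma smooth_on_derive_cst F v : smooth_on A F ->
  smooth_on A (fun p => 'D_v (fun y => F (p.1, y)) p.2).
Proof.
move=> /smooth_onP[ O [G [oO AO CG FG]]].
apply/smooth_onP; exists O, (fun p => 'D_(0, v) G p); split => //.
  by move=> n; have [_ /(_ (0, v))[]] := CG n.+1.
move=> [t x] [/= tT Mx].
by have [_ ->] := slice_space v oO AO CG FG tT Mx.
Qed.

Lemma smooth_on_derive F (X : R * vec -> vec) : smooth_on A F ->
  (forall i, smooth_on A (fun p => X p 0 i)) ->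
  smooth_on A (fun p => 'D_(X p) (fun y => F (p.1, y)) p.2).
Proof.
move=> sF sX.
apply: (smooth_on_eq (F := fun p => \sum_i X p 0 i *
   'D_(Defs.basis i) (fun y => F (p.1, y)) p.2)).
  by move=> [t x] [/= tT Mx]; rewrite [RHS]smooth_derive_coord.
by apply: smooth_on_sum => i; apply: smooth_onM => //; exact: smooth_on_derive_cst.
Qed.

Lemma smooth_on_tderiv F : smooth_on A F ->
  smooth_on A (fun p => tderiv T (fun s => F (s, p.2)) p.1).
Proof.
move=> /smooth_onP[ O [G [oO AO CG FG]]].
apply/smooth_onP; exists O, (fun p => 'D_(1, 0) G p); split => //.
  by move=> n; have [_ /(_ (1, 0))[]] := CG n.+1.
move=> [t x] [/= tT Mx].
by have [_ ->] := slice_time oO AO CG FG tT Mx.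
Qed.

Lemma smooth_slice_continuous F x : smooth_on A F -> M x ->
  {within `[0, T], continuous (fun s => F (s, x))}.
Proof.
move=> sF Mx; apply: tderivable_continuous => // t tT.
exact: smooth_tderivable.
Qed.

Lemma smooth_C1_curve F x : smooth_on A F -> M x -> C1_curve T (fun s => F (s, x)).
Proof.
move=> sF Mx; split=> [t tT|]; first exact: smooth_tderivable.
exact: (smooth_slice_continuous (smooth_on_tderiv sF)).
Qed.

Lemma smooth_on_fst : smooth_on A (fun p => p.1).
Proof.
apply/smooth_onP; exists setT, fst; split => //; first exact: openT.
have dfst (p v : R * vec) : is_derive p v (fst : R * vec -> R) v.1.
  have H : h^-1 *: ((h *: v + p).1 - p.1) @[h --> (0 : R)^'] --> v.1.
    apply: cvg_trans (@cvg_cst _ v.1 _ (0 : R)^' _); apply: near_eq_cvg; near=> h => /=.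
    rewrite addrK scalerA mulVf ?scale1r//; near: h; exact: nbhs_dnbhs_neq.
  by apply: DeriveDef; [apply/cvg_ex; eexists; exact: H|exact: cvg_lim H].
case=> [|n]; first by split=> [p _|]; [exact: cvg_fst|].
split=> [p _|v]; first exact: cvg_fst.
split=> [p _|]; first by have [] := dfst p v.
apply: Cle_eq (Cle_cst n v.1 openT) => //; first exact: openT.
by move=> p _; have [_ ->] := dfst p v.
Unshelve. all: by end_near. Qed.

Lemma smooth_on_flow F (phi : R -> vec -> vec) : smooth_on A F ->
  (forall i, smooth_on A (fun p => phi p.1 p.2 0 i)) ->
  (forall t x, t \in `[0, T] -> M x -> M (phi t x)) ->
  smooth_on A (fun p => F (p.1, phi p.1 p.2)).
Proof.
move=> sF sphi Mphi.
apply: (smooth_on_comp (b := fun p => phi p.1 p.2) sF smooth_on_fst sphi).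
by move=> [t x] [/= tT Mx]; split=> //=; exact: Mphi.
Qed.

(** Total derivative along a trajectory: partial time derivative plus transport by the velocity. The
    chain rule is applied to smooth extensions of F, of time and of phi, and each factor is then
    read back on [0, T] x M. *)
Lemma tderiv_flow F (phi : R -> vec -> vec) t x : smooth_on A F ->
  (forall i, smooth_on A (fun p => phi p.1 p.2 0 i)) ->
  (forall t x, t \in `[0, T] -> M x -> M (phi t x)) ->
  t \in `[0, T] -> M x ->
  tderiv T (fun s => F (s, phi s x)) t =
  tderiv T (fun s => F (s, phi t x)) t
  + 'D_(tderiv T (fun s => phi s x) t) (fun y => F (t, y)) (phi t x).
Proof.
move=> sF sphi Mphi tT Mx.
have Mp := Mphi t x tT Mx.
have [ O2 [G [oO2 AO2 CG FG]]] := (smooth_onP _ _).1 sF.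
have E (p : R * vec) : \row_i phi p.1 p.2 0 i = phi p.1 p.2.
  by apply/rowP => i; rewrite mxE.
have [|O [a' [b' [[oO AO] OO2 [Ca Cb] CFK ab]]]] := comp_extension oO2 CG smooth_on_fst sphi.
  by move=> [s y] [/= sT My]; rewrite (E (s, y)); apply: AO2; split=> //=; exact: Mphi.
have {}ab p : A p -> p.1 = a' p /\ phi p.1 p.2 = b' p.
  by move=> /ab; rewrite E.
have Atx : A (t, x) by [].
have Otx := AO _ Atx.
have FK (p : R * vec) : A p -> F (p.1, phi p.1 p.2) = G (a' p, b' p).
  by case: p => s y sy; have [<- <-] := ab _ sy; rewrite FG//; case: sy => sT My;
    split=> //=; exact: Mphi.
have [_ ->] := slice_time (F := fun p => F (p.1, phi p.1 p.2)) oO AO CFK FK tT Mx.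
have da : derivable a' (t, x) (1, 0).
  exact: ((Ca 1%N).2 (1, 0)).1 _ Otx.
have dbi i : derivable (fun p => b' p 0 i) (t, x) (1, 0).
  exact: ((Cb i 1%N).2 (1, 0)).1 _ Otx.
have db : derivable b' (t, x) (1, 0).
  apply/derivable_mxP => i j; rewrite ord1; exact: dbi.
have [_ ->] := is_derive_chain oO2 (CG 1%N) (OO2 _ Otx) da db.
have [/= <- <-] := ab _ Atx.
rewrite (derive_pair_split _ _ oO2 (CG 1%N)); last by apply: AO2.
(* [a'] is merely some extension of the time coordinate; on [0, T] x M its time derivative is forced
   to be that of the identity. *)
have -> : 'D_(1, 0) a' (t, x) = 1.
  have [_ E1] := slice_time (F := fun p => p.1) oO AO Ca (fun p Ap => (ab p Ap).1) tT Mx.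
  by rewrite -E1; exact: tderiv_id.
rewrite mul1r; congr (_ + _).
  by have [_ ->] := slice_time oO2 AO2 CG FG tT Mp.
have [_ ->] := slice_space (tderiv T (fun s => phi s x) t) oO2 AO2 CG FG tT Mp.
congr ('D_(0, _) G _); apply/rowP => i; rewrite derive_mx// mxE.
have H := slice_time oO AO (Cb i) (F := fun p => phi p.1 p.2 0 i) _ tT Mx.
have [|di <-] := H; first by move=> p Ap; have [_ ->] := ab p Ap.
have dphi : tderivable T (fun s => phi s x) t.
  apply: (tderiv_mx T_gt0 tT) => k j; rewrite ord1.
  exact: (smooth_tderivable (F := fun p => phi p.1 p.2 0 j)).
by have [_ ->] := tderiv_coord T_gt0 0 i tT dphi.
Qed.

End Slices.

(** * Differentiation under the integral sign *)

Section Clamp.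
Context {R : realType} (T : R).
Hypothesis T_gt0 : 0 < T.

(** Retraction of the line onto [0, T]. Composing with it turns continuity within [0, T] into
    continuity on the whole line, so full neighbourhoods of (0, t) can be used even when t is an end
    point. *)
Definition clamp (t : R) : R := Num.max 0 (Num.min t T).

Lemma clamp_itv t : clamp t \in `[0, T].
Proof. by rewrite in_itv/= le_max lexx/= ge_max ltW//= ge_min lexx orbT. Qed.

Lemma clamp_id t : t \in `[0, T] -> clamp t = t.
Proof.
rewrite in_itv/= /clamp => /andP[t0 tT].
by rewrite (min_idPl tT) (max_idPr t0).
Qed.

Lemma continuous_clamp : continuous clamp.
Proof.
move=> t.
have c0 : {for t, continuous (cst 0 : R -> R)} by exact: cvg_cst.
have cT : {for t, continuous (cst T : R -> R)} by exact: cvg_cst.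
have cid : {for t, continuous (id : R -> R)} by exact: cvg_id.
exact: continuous_max c0 (continuous_min cid cT).
Qed.

Lemma continuous_comp_clamp {V : topologicalType} (f : R -> V) :
  {within `[0, T], continuous f} -> continuous (f \o clamp).
Proof.
move=> /subspace_continuousP cf t.
apply: (cvg_comp clamp f _ (cf (clamp t) (clamp_itv t))) => P HP.
have {}HP : \forall s \near t, clamp s \in `[0, T] -> P (clamp s).
  exact: continuous_clamp HP.
suff : \forall s \near t, P (clamp s) by [].
by apply: filterS HP => s; apply; exact: clamp_itv.
Qed.

End Clamp.

Section Variation.
Context {R : realType} (T : R).
Hypothesis T_gt0 : 0 < T.
Local Notation mu := (@lebesgue_measure R).

(** The condition is local in both variables, so it is stable under sums and products, and
    compactness of [0, T] later turns it into a range of e common to all t. *)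
Definition C1_param (t : R) (l g : R * R -> R) := \forall p \near (0, t),
  [/\ {for p, continuous l}, {for p, continuous g} &
      is_derive p.1 (1 : R) (fun e => l (e, p.2)) (g p)].

Lemma C1_paramD t l1 l2 g1 g2 : C1_param t l1 g1 -> C1_param t l2 g2 ->
  C1_param t (fun p => l1 p + l2 p) (fun p => g1 p + g2 p).
Proof.
apply: filterS2 => p [c1 d1 D1] [c2 d2 D2]; split.
- exact: cvgD c1 c2.
- exact: cvgD d1 d2.
- exact: is_deriveD.
Qed.

Lemma C1_paramM t l1 l2 g1 g2 : C1_param t l1 g1 -> C1_param t l2 g2 ->
  C1_param t (fun p => l1 p * l2 p) (fun p => l1 p * g2 p + g1 p * l2 p).
Proof.
apply: filterS2 => p [c1 d1 D1] [c2 d2 D2]; split.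
- exact: cvgM c1 c2.
- exact: cvgD (cvgM c1 d2) (cvgM d1 c2).
- case: p {c1 c2 d1 d2} D1 D2 => e s /= D1 D2.
  have := is_deriveM D1 D2.
  by rewrite /GRing.scale/= (mulrC (l2 _)).
Qed.

Lemma C1_param_cst t (a : R) : C1_param t (fun=> a) (fun=> 0).
Proof.
near=> p; split; [exact: cvg_cst|exact: cvg_cst|exact: is_derive_cst].
Unshelve. all: by end_near. Qed.

(** The tube lemma for the compact segment [0, T]. *)
Lemma near_uniform (P : R * R -> Prop) :
  (forall t, t \in `[0, T] -> \forall p \near (0, t), P p) ->
  \forall e \near (0 : R), forall t, t \in `[0, T] -> P (e, t).
Proof.
move=> HP.
have /compact_near_coveringP := @segment_compact R 0 T.
move=> /(_ R (nbhs (0 : R)) (fun e t => P (e, t)) _) H.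
apply: H => t tT; have [[/= U W] [nU nW] UW] := HP t tT.
by exists (W, U) => // -[s e] [/= Ws Ue]; exact: (UW (e, s)).
Qed.

Lemma continuous_at_slice (l : R * R -> R) e t :
  {for (e, t), continuous l} -> {for t, continuous (fun s => l (e, s))}.
Proof.
move=> cl; apply: (continuous_comp_pair (a := fun=> e) (b := id)) => //.
exact: cvg_cst.
Qed.

Lemma continuous_at_within (A : set R) (f : R -> R) :
  (forall t, A t -> {for t, continuous f}) -> {within A, continuous f}.
Proof.
move=> cf; apply/subspace_continuousP => t At.
exact: cvg_within_filter (cf t At).
Qed.

Lemma is_derive_integral (l g : R * R -> R) :
  (forall t, t \in `[0, T] -> C1_param t l g) ->
  is_derive (0 : R) (1 : R) (fun e => \int[mu]_(t in `[0, T]) l (e, t))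
    (\int[mu]_(t in `[0, T]) g (0, t)).
Proof.
move=> C1.
have cg0 : {within `[0, T], continuous (fun t => `|g (0, t)|)}.
  apply: continuous_at_within => t tT.
  have [_ cg _] := nbhs_singleton (C1 t tT).
  exact: cvg_norm (continuous_at_slice cg).
have [c cT Hc] := EVT_max (ltW T_gt0) cg0.
(* The extra 1 leaves room for the bound on |g(e, t)| to persist for small e, by continuity; the
   constant C is then the integrable dominating function. *)
pose C := `|g (0, c)| + 1.
have : \forall e \near (0 : R), forall t, t \in `[0, T] ->
    [/\ {for (e, t), continuous l},
        is_derive e (1 : R) (fun e => l (e, t)) (g (e, t)) & `|g (e, t)| <= C].
  apply: (near_uniform (P := fun p => [/\ {for p, continuous l},
    is_derive p.1 (1 : R) (fun e => l (e, p.2)) (g p) & `|g p| <= C])) => t tT.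
  have [_ cg _] := nbhs_singleton (C1 t tT).
  have gC : \forall p \near (0, t), `|g p| <= C.
    have ng : `|g p| @[p --> (0, t)] --> `|g (0, t)| by exact: cvg_norm cg.
    have gltC : `|g (0, t)| < C by rewrite (le_lt_trans (Hc t tT))// ltrDl.
    exact: cvgr_le ng _ gltC.
  by move: (C1 t tT) gC; apply: filterS2 => p [].
case=> r /= r0 Hr.
have {}Hr e : e \in `]- r, r[ -> forall t, t \in `[0, T] ->
    [/\ {for (e, t), continuous l},
        is_derive e (1 : R) (fun e => l (e, t)) (g (e, t)) & `|g (e, t)| <= C].
  by rewrite in_itv/= => er; apply: Hr; rewrite /= sub0r normrN ltr_norml.
have I0 : (0 : R) \in `]- r, r[ by rewrite in_itv/= oppr_lt0 r0.
have mT : measurable (`[0, T]%classic : set (measurableTypeR R)).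
  exact: measurable_itv.
have int_l e : `]- r, r[%classic e -> mu.-integrable `[0, T] (EFin \o (fun t => l (e, t))).
  move=> er; apply: continuous_compact_integrable; first exact: segment_compact.
  apply: continuous_at_within => t tT; have [cl _ _] := Hr e er t tT.
  exact: continuous_at_slice cl.
have der_l e t : `]- r, r[%classic e -> `[0, T]%classic t ->
    derivable (fun e => l (e, t)) e 1.
  by move=> er tT; have [_ [] ] := Hr e er t tT.
have int_C : mu.-integrable `[0, T] (EFin \o (fun=> C)).
  apply: continuous_compact_integrable; first exact: segment_compact.
  by apply: continuous_at_within => t _; exact: cvg_cst.
have C0 (t : measurableTypeR R) : 0 <= C by rewrite addr_ge0.
have bound e t : `]- r, r[%classic e -> `[0, T]%classic t ->
    `|partial1of2 (fun e t => l (e, t)) e t| <= (fun=> C) t.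
  move=> er tT; have [_ [_ D] gC] := Hr e er t tT.
  by rewrite partial1of2E D.
have dF := derivable_under_integral mT I0 int_l der_l C0 int_C bound.
have EF := differentiation_under_integral mT I0 int_l der_l C0 int_C bound.
apply: DeriveDef; first exact: dF.
rewrite -derive1E EF; apply: eq_Rintegral => t /[!inE] tT.
have [_ [_ D] _] := Hr 0 I0 t tT.
by rewrite -derive1E in D.
Qed.

Lemma C1_curve_LRcontinuous (f : R -> R) : C1_curve T f ->
  derivable_oo_LRcontinuous f 0 T.
Proof.
move=> Hf; have [_ c0 cT] := (continuous_within_itvP f T_gt0).1 (C1_curve_cont Hf).
split=> // t tT.
by have [] := tderiv_interior tT (Hf.1 t (subset_itv_oo_cc tT)).
Qed.

Lemma derive1_tderiv (f : R -> R) : C1_curve T f ->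
  {in `]0, T[, f^`()%classic =1 tderiv T f}.
Proof.
move=> Hf t tT; rewrite derive1E.
by have [_ ->] := tderiv_interior tT (Hf.1 t (subset_itv_oo_cc tT)).
Qed.

Lemma integral_by_parts (P h : R -> R) : C1_curve T P -> C1_curve T h ->
  h 0 = 0 -> h T = 0 ->
  \int[mu]_(t in `[0, T]) (P t * tderiv T h t) =
  - \int[mu]_(t in `[0, T]) (tderiv T P t * h t).
Proof.
move=> HP Hh h0 hT.
rewrite (Rintegration_by_parts T_gt0 HP.2 (C1_curve_LRcontinuous HP) (derive1_tderiv HP)
  Hh.2 (C1_curve_LRcontinuous Hh) (derive1_tderiv Hh)).
by rewrite h0 hT !mulr0 subrr sub0r.
Qed.

Lemma continuous_integrable (f : R -> R) : {within `[0, T], continuous f} ->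
  mu.-integrable `[0, T] (EFin \o f).
Proof.
move=> cf; apply: continuous_compact_integrable => //; exact: segment_compact.
Qed.

(** The primitive of [h] is nondecreasing and vanishes at both ends, so it is constantly 0, and its
    derivative [h] vanishes in the interior. *)
Lemma integral0_nonneg (h : R -> R) : {within `[0, T], continuous h} ->
  (forall t, t \in `[0, T] -> 0 <= h t) ->
  \int[mu]_(t in `[0, T]) h t = 0 -> forall t, t \in `]0, T[ -> h t = 0.
Proof.
move=> ch h0 I0.
have ih := continuous_integrable ch.
pose H x := \int[mu]_(t in `[0, x]) h t.
have dH t : t \in `]0, T[ -> derivable H t 1 /\ H^`()%classic t = h t.
  move=> tT; have /andP[t0 tT'] : 0 < t < T by rewrite in_itv in tT.
  apply: (continuous_FTC1_closed tT' ih t0).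
  have [c _ _] := (continuous_within_itvP h T_gt0).1 ch; exact: c.
have cH : {within `[0, T], continuous H}.
  exact: parameterized_integral_continuous (ltW T_gt0) ih.
have mH x y : 0 <= x -> x <= y -> y <= T -> H x <= H y.
  move=> x0 xy yT.
  apply: (@ger0_derive1_le_cc R H 0 T _ _ cH) => //.
  - by move=> t tT; exact: (dH t tT).1.
  - by move=> t tT; rewrite (dH t tT).2 h0//; exact: subset_itv_oo_cc tT.
  - by rewrite in_itv/= x0 (le_trans xy).
  - by rewrite in_itv/= yT (le_trans x0).
have H00 : H 0 = 0 by rewrite /H set_itv1 Rintegral_set1.
have HE t : t \in `]0, T[ -> H t = 0.
  rewrite in_itv/= => /andP[t0 tT]; apply/eqP; rewrite eq_le; apply/andP; split.
    have <- : H T = 0 by exact: I0.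
    by apply: mH => //; exact: ltW.
  have <- : H 0 = 0 by exact: H00.
  by apply: mH => //; exact: ltW.
move=> t tT; rewrite -(dH t tT).2 derive1E.
rewrite (@near_eq_derive _ _ _ _ (cst 0)) ?derive_cst//.
near=> s; apply: HE; near: s; exact: near_in_itvoo.
Unshelve. all: by end_near. Qed.

End Variation.

(** * First variation of a Lagrangian *)

Section Varies.
Context {R : realType} {d : nat} (T : R) (M : set 'rV[R]_d).
Hypotheses (T_gt0 : 0 < T) (oM : open M).
Local Notation vec := 'rV[R]_d.
Local Notation A := (`[0, T] `*` M).
Local Notation mu := (@lebesgue_measure R).
Variables (c eta : R -> vec).
Hypotheses (path_c : path_in T M c) (C1_eta : C1_curve T eta).

(* [delta] is the first variation of [L]; as [L e t] is meaningless when
   [c t + e eta t] leaves [M] or [t] leaves [0, T], it is only required to agree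
   elsewhere with a function [l] that is C^1 in [e] near [e = 0]. *)
Definition varies (L : R -> R -> R) (delta : R -> R) : Prop :=
  exists l g : R * R -> R, [/\ forall t, t \in `[0, T] -> C1_param t l g,
    forall e t, t \in `[0, T] -> M (c t + e *: eta t) -> L e t = l (e, t)
    & forall t, t \in `[0, T] -> g (0, t) = delta t].

Lemma varies_eq L L' delta delta' : varies L delta ->
  (forall e t, t \in `[0, T] -> M (c t + e *: eta t) -> L e t = L' e t) ->
  (forall t, t \in `[0, T] -> delta t = delta' t) -> varies L' delta'.
Proof.
move=> [l [g [C1 Ll gd]]] LL' dd; exists l, g; split=> // [e t tT Mt|t tT].
  by rewrite -LL'// Ll.
by rewrite -dd// gd.
Qed.

Lemma variesD L1 L2 d1 d2 : varies L1 d1 -> varies L2 d2 ->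
  varies (fun e t => L1 e t + L2 e t) (fun t => d1 t + d2 t).
Proof.
move=> [l1 [g1 [C1 Ll1 gd1]]] [l2 [g2 [C2 Ll2 gd2]]].
exists (fun p => l1 p + l2 p), (fun p => g1 p + g2 p); split.
- by move=> t tT; apply: C1_paramD; [exact: C1|exact: C2].
- by move=> e t tT Mt; rewrite Ll1// Ll2.
- by move=> t tT; rewrite gd1// gd2.
Qed.

Lemma variesM L1 L2 d1 d2 : varies L1 d1 -> varies L2 d2 ->
  varies (fun e t => L1 e t * L2 e t) (fun t => L1 0 t * d2 t + d1 t * L2 0 t).
Proof.
move=> [l1 [g1 [C1 Ll1 gd1]]] [l2 [g2 [C2 Ll2 gd2]]].
exists (fun p => l1 p * l2 p), (fun p => l1 p * g2 p + g1 p * l2 p); split.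
- by move=> t tT; apply: C1_paramM; [exact: C1|exact: C2].
- by move=> e t tT Mt; rewrite Ll1// Ll2.
- move=> t tT; have Mt : M (c t + 0 *: eta t).
    by rewrite scale0r addr0; exact: path_c.2.
  by rewrite gd1// gd2// Ll1// Ll2.
Qed.

Lemma varies_cst a : varies (fun _ _ => a) (fun=> 0).
Proof. by exists (fun=> a), (fun=> 0); split=> // t tT; exact: C1_param_cst. Qed.

Lemma variesN L delta : varies L delta -> varies (fun e t => - L e t) (fun t => - delta t).
Proof.
move=> vL; apply: (varies_eq (variesM (varies_cst (- 1)) vL)) => [e t _ _|t _].
  by rewrite mulN1r.
by rewrite mul0r addr0 mulN1r.
Qed.

Lemma varies_sum (I : Type) (r : seq I) (L : I -> R -> R -> R) (delta : I -> R -> R) :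
  (forall i, varies (L i) (delta i)) ->
  varies (fun e t => \sum_(i <- r) L i e t) (fun t => \sum_(i <- r) delta i t).
Proof.
move=> vL; elim: r => [|i r IH].
  by apply: (varies_eq (varies_cst 0)) => [e t _ _|t _]; rewrite big_nil.
by apply: (varies_eq (variesD (vL i) IH)) => [e t _ _|t _]; rewrite big_cons.
Qed.

Local Notation cl := (clamp T).

Lemma continuous_variation :
  continuous (fun p : R * R => c (cl p.2) + p.1 *: eta (cl p.2)).
Proof.
move=> p.
have cc := continuous_comp_clamp T_gt0 (C1_curve_cont path_c.1).
have ce := continuous_comp_clamp T_gt0 (C1_curve_cont C1_eta).
have snd_c : {for p, continuous (snd : R * R -> R)} by exact: cvg_snd.
have fst_c : {for p, continuous (fst : R * R -> R)} by exact: cvg_fst.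
have h1 : {for p, continuous (fun p : R * R => c (cl p.2))}.
  exact: (cvg_comp snd (c \o cl) snd_c (cc p.2)).
have h2 : {for p, continuous (fun p : R * R => eta (cl p.2))}.
  exact: (cvg_comp snd (eta \o cl) snd_c (ce p.2)).
apply: cvgD h1 _; exact: cvgZ fst_c h2.
Qed.

Lemma near_variation_in t : t \in `[0, T] ->
  \forall p \near ((0 : R), t), M (c (cl p.2) + p.1 *: eta (cl p.2)).
Proof.
move=> tT.
pose v (p : R * R) := c (cl p.2) + p.1 *: eta (cl p.2).
have n : nbhs (v (0, t)) M.
  apply: open_nbhs_nbhs; split => //; rewrite /v/= scale0r addr0.
  exact: (path_c.2 _ (clamp_itv T_gt0 t)).
have cv : {for ((0 : R), t), continuous v} by exact: continuous_variation.
exact: (cv M n).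
Qed.

(** Openness of M gives a range of e around each t; compactness of [0, T] makes it uniform. *)
Lemma variation_in : \forall e \near (0 : R), forall t, t \in `[0, T] ->
  M (c t + e *: eta t).
Proof.
have := near_uniform (P := fun p => M (c (cl p.2) + p.1 *: eta (cl p.2)))
  near_variation_in.
by apply: filterS => e He t tT; have := He t tT; rewrite /= clamp_id.
Qed.

Lemma is_derive_affine {V : normedModType R} (y v : V) (e : R) :
  is_derive e (1 : R) (fun e => y + e *: v) v.
Proof.
have H : h^-1 *: ((y + (h *: 1 + e) *: v) - (y + e *: v)) @[h --> (0 : R)^'] --> v.
  apply: cvg_trans (@cvg_cst _ v _ (0 : R)^' _); apply: near_eq_cvg; near=> h => /=.
  rewrite [_%:A]mulr1 opprD addrACA subrr add0r -scalerBl addrK scalerA mulVf ?scale1r//.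
  near: h; exact: nbhs_dnbhs_neq.
by apply: DeriveDef; [apply/cvg_ex; eexists; exact: H|exact: cvg_lim H].
Unshelve. all: by end_near. Qed.

Lemma varies_integral L delta : varies L delta ->
  is_derive (0 : R) (1 : R) (fun e => \int[mu]_(t in `[0, T]) L e t)
    (\int[mu]_(t in `[0, T]) delta t).
Proof.
move=> [l [g [C1 Ll gd]]].
have -> : \int[mu]_(t in `[0, T]) delta t = \int[mu]_(t in `[0, T]) g (0, t).
  by apply: eq_Rintegral => t /[!inE] tT; rewrite gd.
(* The integrals of [L] and of its representative [l] are only known to agree for small e, while the
   whole curve stays in M; that is enough for the derivative at 0. *)
apply: near_eq_is_derive (is_derive_integral T_gt0 C1).
have := variation_in; apply: filterS => e He.
by apply: eq_Rintegral => t /[!inE] tT; rewrite Ll//; exact: He.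
Qed.

Lemma varies_velocity i :
  varies (fun e t => tderiv T c t 0 i + e * tderiv T eta t 0 i)
    (fun t => tderiv T eta t 0 i).
Proof.
pose c' s := tderiv T c (cl s) 0 i; pose eta' s := tderiv T eta (cl s) 0 i.
have cc : continuous c'.
  apply: (continuous_comp_clamp (f := fun s => tderiv T c s 0 i) T_gt0).
  exact: ((within_continuous_coord _ _).1 path_c.1.2).
have ce : continuous eta'.
  apply: (continuous_comp_clamp (f := fun s => tderiv T eta s 0 i) T_gt0).
  exact: ((within_continuous_coord _ _).1 C1_eta.2).
exists (fun p => c' p.2 + p.1 * eta' p.2), (fun p => eta' p.2); split.
- move=> t tT; near=> p.
  have snd_c : {for p, continuous (snd : R * R -> R)} by exact: cvg_snd.
  have fst_c : {for p, continuous (fst : R * R -> R)} by exact: cvg_fst.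
  have h1 : {for p, continuous (fun p : R * R => c' p.2)}.
    exact: (cvg_comp snd c' snd_c (cc p.2)).
  have h2 : {for p, continuous (fun p : R * R => eta' p.2)}.
    exact: (cvg_comp snd eta' snd_c (ce p.2)).
  split=> //=; first by apply: cvgD h1 _; exact: cvgM fst_c h2.
  exact: is_derive_affine.
- by move=> e t tT _; rewrite /c' /eta' /= clamp_id.
- by move=> t tT; rewrite /eta' /= clamp_id.
Unshelve. all: by end_near. Qed.

Lemma varies_smooth F : smooth_on A F ->
  varies (fun e t => F (t, c t + e *: eta t))
    (fun t => 'D_(eta t) (fun y => F (t, y)) (c t)).
Proof.
move=> sF; have [ O [G [oO AO CG FG]]] := (smooth_onP _ _).1 sF.
pose K (p : R * R) := (cl p.2, c (cl p.2) + p.1 *: eta (cl p.2)).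
(* The direction [eta] moves with p, whereas [Cle] yields continuity of a directional derivative for
   a fixed direction; hence the expansion along the basis. *)
pose g p := \sum_i eta (cl p.2) 0 i * 'D_(0, Defs.basis i) G (K p).
have cK : continuous K.
  move=> p; have snd_c : {for p, continuous (snd : R * R -> R)} by exact: cvg_snd.
  have h1 : {for p, continuous (fun p : R * R => cl p.2)}.
    exact: (cvg_comp snd cl snd_c (@continuous_clamp _ _ p.2)).
  have h2 : {for p, continuous (fun p : R * R => c (cl p.2) + p.1 *: eta (cl p.2))}.
    exact: continuous_variation.
  have : {for p, continuous (fun p : R * R =>
      (cl p.2, c (cl p.2) + p.1 *: eta (cl p.2)))} by exact: cvg_pair h1 h2.
  exact.
have ceta i : continuous (fun p : R * R => eta (cl p.2) 0 i).
  move=> p; have snd_c : {for p, continuous (snd : R * R -> R)} by exact: cvg_snd.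
  have ce := continuous_comp_clamp T_gt0 (C1_curve_cont C1_eta).
  have h2 : {for p, continuous (fun p : R * R => eta (cl p.2))}.
    exact: (cvg_comp snd (eta \o cl) snd_c (ce p.2)).
  exact: cvg_comp _ _ h2 (@coord_continuous R 1 d 0 i _).
exists (G \o K), g; split.
- move=> t tT.
  have OK : \forall p \near (0, t), O (K p).
    have K0 : nbhs (K (0, t)) O.
      apply: open_nbhs_nbhs; split => //; apply: AO; split => /=.
        exact: clamp_itv.
      by rewrite scale0r addr0; exact: (path_c.2 _ (clamp_itv T_gt0 t)).
    exact: (cK (0, t) O K0).
  apply: filterS OK => p OKp; split.
  + have cKp : {for p, continuous K} by exact: cK.
    exact: (continuous_comp cKp (Cle_cont (CG 0%N) OKp)).
  + apply: cvg_big => [|i _]; first exact: add_continuous.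
    apply: cvgM; first exact: ceta.
    have [_ /(_ (0, Defs.basis i))[_ CDG]] := CG 1%N.
    have cKp : {for p, continuous K} by exact: cK.
    have DGp : {for K p, continuous (fun q => 'D_(0, Defs.basis i) G q)}.
      exact: CDG.1 _ OKp.
    exact: (continuous_comp cKp DGp).
  + pose a := cst (cl p.2) : R -> R.
    pose b e := c (cl p.2) + e *: eta (cl p.2).
    have [db Eb] := is_derive_affine (c (cl p.2)) (eta (cl p.2)) p.1.
    have da : derivable a p.1 1 by exact: derivable_cst.
    have Oab : O (a p.1, b p.1) by exact: OKp.
    have [_ E] := C1_diff oO (CG 1%N) Oab.
    have [H1 H2] := is_derive_chain oO (CG 1%N) Oab da db.
    apply: DeriveDef; first exact: H1.
    rewrite -[LHS]/('D_1 (fun e => G (a e, b e)) p.1) H2 Eb derive_cst.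
    by rewrite (E (0, eta (cl p.2))) mul0r add0r.
- by move=> e t tT Mt; rewrite FG//= /K/= clamp_id.
- move=> t tT; rewrite /g /K /= clamp_id// scale0r addr0.
  have Mc := path_c.2 t tT.
  rewrite (smooth_derive_coord oM _ sF)//; apply: eq_bigr => i _.
  by have [_ ->] := slice_space oM (Defs.basis i) oO AO CG FG tT Mc.
Qed.

End Varies.

Section Lagrangian.
Context {R : realType} {d : nat} (T : R) (M : set 'rV[R]_d).
Hypotheses (T_gt0 : 0 < T) (oM : open M).
Local Notation vec := 'rV[R]_d.
Local Notation A := (`[0, T] `*` M).
Local Notation mu := (@lebesgue_measure R).
Variables (g : R -> vec -> 'M[R]_d) (z : R -> vec -> vec) (f : R -> vec -> R).
Hypotheses (sg : forall i j, smooth_on A (fun p => g p.1 p.2 i j)).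
Hypotheses (sz : forall i, smooth_on A (fun p => z p.1 p.2 0 i)).
Hypotheses (sf : smooth_on A (fun p => f p.1 p.2)).
Hypothesis g_sym : forall t x i j, t \in `[0, T] -> M x -> g t x i j = g t x j i.

Definition slip (c : R -> vec) (t : R) (i : 'I_d) : R :=
  tderiv T c t 0 i - z t (c t) 0 i.

Definition momentum c t i : R := \sum_j g t (c t) i j * slip c t j.

(** Partial derivative of the Lagrangian in the k-th position coordinate, the velocity being frozen;
    the drift z enters through the velocity slot and accounts for the minus sign. *)
Definition force c t k : R :=
  2^-1 * (\sum_i \sum_j 'D_(Defs.basis k) (fun y => g t y i j) (c t) * (slip c t i * slip c t j))
  - \sum_i momentum c t i * 'D_(Defs.basis k) (fun y => z t y 0 i) (c t)
  + 'D_(Defs.basis k) (fun y => f t y) (c t).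

Lemma inner_sum t x v w : inner (g t) x v w = \sum_i v 0 i * (\sum_j g t x i j * w 0 j).
Proof.
rewrite /inner mxE; under eq_bigr do rewrite !mxE mulr_suml.
rewrite exchange_big/=; apply: eq_bigr => i _; rewrite mulr_sumr.
by apply: eq_bigr => j _; rewrite mulrA.
Qed.

Lemma lagrangian_varies c eta : path_in T M c -> C1_curve T eta ->
  varies T M c eta
    (fun e t => 2^-1 * inner (g t) (c t + e *: eta t)
        (tderiv T c t + e *: tderiv T eta t - z t (c t + e *: eta t))
        (tderiv T c t + e *: tderiv T eta t - z t (c t + e *: eta t))
      + f t (c t + e *: eta t))
    (fun t => \sum_i (momentum c t i * tderiv T eta t 0 i + force c t i * eta t 0 i)).
Proof.
move=> pc C1e.
have vq i := variesD (varies_velocity T_gt0 pc C1e i)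
  (variesN pc (varies_smooth T_gt0 oM pc C1e (sz i))).
have vg i j := varies_smooth T_gt0 oM pc C1e (sg i j).
have vgq i := varies_sum (index_enum 'I_d) (fun j => variesM pc (vg i j) (vq j)).
have vK := varies_sum (index_enum 'I_d) (fun i => variesM pc (vq i) (vgq i)).
have vL := variesD (variesM pc (varies_cst T M c eta 2^-1) vK)
  (varies_smooth T_gt0 oM pc C1e sf).
apply: varies_eq vL _ _ => [e t tT Mt|t tT] /=.
  rewrite inner_sum; congr (_ * _ + _); apply: eq_bigr => i _.
  by rewrite !mxE; congr (_ * _); apply: eq_bigr => j _; rewrite !mxE.
have Mc := pc.2 t tT.
pose Dz i := 'D_(eta t) (fun y => z t y 0 i) (c t).
pose Dg i j := 'D_(eta t) (fun y => g t y i j) (c t).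
pose Df := 'D_(eta t) (fun y => f t y) (c t).
pose q i := slip c t i.
pose dq i := tderiv T eta t 0 i - Dz i.
rewrite !scale0r !addr0 !mul0r !addr0.
transitivity (2^-1 * (\sum_i \sum_j (q i * (g t (c t) i j * dq j)
     + q i * (Dg i j * q j) + dq i * (g t (c t) i j * q j))) + Df).
  congr (_ * _ + _); apply: eq_bigr => i _; rewrite !mulr_sumr -big_split/=.
  apply: eq_bigr => j _.
  by rewrite ?scale0r ?addr0 ?mul0r ?addr0 -/(q i) -mulrDr.
(* By symmetry of g, varying either slot of g(q, q) gives the same pairing of the momentum with the
   variation of q; the two copies absorb the factor 1/2. *)
have E1 : \sum_i \sum_j q i * (g t (c t) i j * dq j) = \sum_i momentum c t i * dq i.
  rewrite exchange_big/=; apply: eq_bigr => j _; rewrite /momentum mulr_suml.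
  by apply: eq_bigr => i _; rewrite (g_sym i j tT Mc) -/(q i); ring.
have E2 : \sum_i \sum_j dq i * (g t (c t) i j * q j) = \sum_i momentum c t i * dq i.
  by apply: eq_bigr => i _; rewrite -mulr_sumr mulrC.
have -> : \sum_i \sum_j (q i * (g t (c t) i j * dq j)
     + q i * (Dg i j * q j) + dq i * (g t (c t) i j * q j)) =
   \sum_i \sum_j q i * (g t (c t) i j * dq j) + \sum_i \sum_j q i * (Dg i j * q j)
   + \sum_i \sum_j dq i * (g t (c t) i j * q j).
  by rewrite -!big_split/=; apply: eq_bigr => i _; rewrite -!big_split.
rewrite big_split/= E1 E2.
(* Expanding the direction [eta t] in the basis exhibits each directional derivative as a
   combination of the [eta t 0 k], whose coefficients add up to the force. *)
have EDz i : Dz i = \sum_k eta t 0 k * 'D_(Defs.basis k) (fun y => z t y 0 i) (c t).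
  exact: (smooth_derive_coord oM (eta t) (sz i) tT Mc).
have EDg i j : Dg i j = \sum_k eta t 0 k * 'D_(Defs.basis k) (fun y => g t y i j) (c t).
  exact: (smooth_derive_coord oM (eta t) (sg i j) tT Mc).
have EDf : Df = \sum_k eta t 0 k * 'D_(Defs.basis k) (fun y => f t y) (c t).
  exact: (smooth_derive_coord oM (eta t) sf tT Mc).
have E3 : \sum_i \sum_j q i * (Dg i j * q j) = \sum_k (\sum_i \sum_j
    'D_(Defs.basis k) (fun y => g t y i j) (c t) * (q i * q j)) * eta t 0 k.
  under [RHS]eq_bigr do rewrite mulr_suml.
  rewrite [RHS]exchange_big/=; apply: eq_bigr => i _.
  under [RHS]eq_bigr do rewrite mulr_suml.
  rewrite [RHS]exchange_big/=; apply: eq_bigr => j _.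
  rewrite EDg mulr_suml mulr_sumr; apply: eq_bigr => k _; ring.
have E4 : \sum_i momentum c t i * dq i = \sum_i momentum c t i * tderiv T eta t 0 i
   - \sum_k (\sum_i momentum c t i * 'D_(Defs.basis k) (fun y => z t y 0 i) (c t)) * eta t 0 k.
  under eq_bigr do rewrite mulrBr.
  rewrite sumrB; congr (_ - _).
  under [RHS]eq_bigr do rewrite mulr_suml.
  rewrite [RHS]exchange_big/=; apply: eq_bigr => i _.
  rewrite EDz mulr_sumr; apply: eq_bigr => k _; ring.
rewrite E3 E4 EDf.
have -> : \sum_i force c t i * eta t 0 i =
   2^-1 * (\sum_k (\sum_i \sum_j
    'D_(Defs.basis k) (fun y => g t y i j) (c t) * (q i * q j)) * eta t 0 k)
  - \sum_k (\sum_i momentum c t i * 'D_(Defs.basis k) (fun y => z t y 0 i) (c t)) * eta t 0 k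
  + \sum_k eta t 0 k * 'D_(Defs.basis k) (fun y => f t y) (c t).
  rewrite mulr_sumr -sumrB -big_split/=; apply: eq_bigr => k _.
  by rewrite /force /q; ring.
by field.
Qed.

End Lagrangian.

(** * The Euler-Lagrange equation *)

Section EulerLagrange.
Context {R : realType} {d : nat} (T : R) (M : set 'rV[R]_d).
Hypotheses (T_gt0 : 0 < T) (oM : open M).
Local Notation vec := 'rV[R]_d.
Local Notation A := (`[0, T] `*` M).
Local Notation mu := (@lebesgue_measure R).

Lemma within0_itv (f : R -> R) : {within `[0, T], continuous f} ->
  (forall t, t \in `]0, T[ -> f t = 0) -> forall t, t \in `[0, T] -> f t = 0.
Proof.
move=> /(continuous_within_itvP f T_gt0)[_ f0 fT] fE t.
rewrite in_itv/= => /andP[t0 tT].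
have := t0; rewrite le_eqVlt => /predU1P[<-|t0'].
  have : f s @[s --> 0^'+] --> (0 : R).
    apply: cvg_trans (@cvg_cst _ (0 : R) _ (0 : R)^'+ _); apply: near_eq_cvg.
    near=> s; rewrite fE// in_itv/=; apply/andP; split.
      by near: s; exact: nbhs_right_gt.
    by near: s; exact: nbhs_right_lt.
  move=> H; exact: (cvg_unique _ f0 H).
have := tT; rewrite le_eqVlt => /predU1P[->|tT'].
  have : f s @[s --> T^'-] --> (0 : R).
    apply: cvg_trans (@cvg_cst _ (0 : R) _ T^'- _); apply: near_eq_cvg.
    near=> s; rewrite fE// in_itv/=; apply/andP; split.
      by near: s; exact: nbhs_left_gt.
    by near: s; exact: nbhs_left_lt.
  move=> H; exact: (cvg_unique _ fT H).
by rewrite fE// in_itv/= t0' tT'.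
Unshelve. all: by end_near. Qed.

Lemma Rintegral_sum (I : Type) (r : seq I) (F : I -> R -> R) :
  (forall i, {within `[0, T], continuous (F i)}) ->
  \int[mu]_(t in `[0, T]) (\sum_(i <- r) F i t) =
  \sum_(i <- r) \int[mu]_(t in `[0, T]) F i t.
Proof.
move=> cF.
have csum (s : seq I) : {within `[0, T], continuous (fun t => \sum_(i <- s) F i t)}.
  apply/subspace_continuousP => t tT; apply: cvg_big => [|i _].
    exact: add_continuous.
  by have /subspace_continuousP := cF i; exact.
elim: r => [|i r IH].
  rewrite big_nil; under eq_Rintegral do rewrite big_nil.
  by rewrite Rintegral_cst ?mul0r//; exact: measurable_itv.
rewrite big_cons -IH; under eq_Rintegral do rewrite big_cons.
rewrite RintegralD//; [exact: continuous_integrable|exact: continuous_integrable].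
Qed.

Variables (g : R -> vec -> 'M[R]_d) (z : R -> vec -> vec) (f : R -> vec -> R).
Hypotheses (sg : forall i j, smooth_on A (fun p => g p.1 p.2 i j)).
Hypotheses (sz : forall i, smooth_on A (fun p => z p.1 p.2 0 i)).
Hypotheses (sf : smooth_on A (fun p => f p.1 p.2)).
Variable phi : R -> vec -> vec.
Hypothesis sphi : forall i, smooth_on A (fun p => phi p.1 p.2 0 i).
Hypothesis Mphi : forall t x, t \in `[0, T] -> M x -> M (phi t x).

Local Notation curve x := (fun t => phi t x).

Lemma flow_path x : M x -> path_in T M (curve x).
Proof.
move=> Mx; split; last by move=> t tT; exact: Mphi.
by apply/(C1_curve_mxP T_gt0) => i j; rewrite ord1; exact: (smooth_C1_curve T_gt0 (sphi j) Mx).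
Qed.

Lemma smooth_velocity i : smooth_on A (fun p => tderiv T (curve p.2) p.1 0 i).
Proof.
apply: smooth_on_eq (smooth_on_tderiv T_gt0 (sphi i)) => -[t x] [/= tT Mx].
by have [_ ->] := tderiv_coord T_gt0 0 i tT ((flow_path Mx).1.1 t tT).
Qed.

Lemma smooth_slip i : smooth_on A (fun p => slip T z (curve p.2) p.1 i).
Proof.
apply: smooth_onD; first exact: smooth_velocity.
apply: smooth_onN; exact: (smooth_on_flow (sz i) sphi Mphi).
Qed.

Lemma smooth_momentum i : smooth_on A (fun p => momentum T g z (curve p.2) p.1 i).
Proof.
apply: smooth_on_sum => j; apply: smooth_onM; last exact: smooth_slip.
exact: (smooth_on_flow (sg i j) sphi Mphi).
Qed.

Lemma smooth_flow_derive (F : R * vec -> R) k : smooth_on A F ->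
  smooth_on A (fun p => 'D_(Defs.basis k) (fun y => F (p.1, y)) (phi p.1 p.2)).
Proof.
move=> sF; exact: (smooth_on_flow (smooth_on_derive_cst oM (Defs.basis k) sF) sphi Mphi).
Qed.

Lemma smooth_force k : smooth_on A (fun p => force T g z f (curve p.2) p.1 k).
Proof.
apply: smooth_onD; last exact: (smooth_flow_derive k sf).
apply: smooth_onD.
  apply: smooth_onM; first exact: smooth_on_cst.
  apply: smooth_on_sum => i; apply: smooth_on_sum => j.
  apply: smooth_onM; first exact: (smooth_flow_derive k (sg i j)).
  by apply: smooth_onM; exact: smooth_slip.
apply: smooth_onN; apply: smooth_on_sum => i.
apply: smooth_onM; first exact: smooth_momentum.
exact: (smooth_flow_derive k (sz i)).
Qed.

(** It is kept as a function of (t, x) so that [smooth_on] applies to it and its slices are C^1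
    curves up to the end points, as the choice of test direction demands. *)
Definition euler_lagrange (p : R * vec) (i : 'I_d) : R :=
  force T g z f (curve p.2) p.1 i - tderiv T (fun s => momentum T g z (curve p.2) s i) p.1.

Lemma smooth_euler_lagrange i : smooth_on A (fun p => euler_lagrange p i).
Proof.
apply: smooth_onD; first exact: smooth_force.
apply: smooth_onN; exact: (smooth_on_tderiv T_gt0 (smooth_momentum i)).
Qed.

Lemma within_continuousM (F G : R -> R) : {within `[0, T], continuous F} ->
  {within `[0, T], continuous G} -> {within `[0, T], continuous (fun t => F t * G t)}.
Proof.
move=> /subspace_continuousP cF /subspace_continuousP cG.
by apply/subspace_continuousP => t tT; apply: cvgM; [exact: cF|exact: cG].
Qed.

Lemma within_continuousD (F G : R -> R) : {within `[0, T], continuous F} ->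
  {within `[0, T], continuous G} -> {within `[0, T], continuous (fun t => F t + G t)}.
Proof.
move=> /subspace_continuousP cF /subspace_continuousP cG.
by apply/subspace_continuousP => t tT; apply: cvgD; [exact: cF|exact: cG].
Qed.

Lemma variation_by_parts x (eta : R -> vec) : M x -> C1_curve T eta ->
  eta 0 = 0 -> eta T = 0 ->
  \int[mu]_(t in `[0, T]) (\sum_i (momentum T g z (curve x) t i * tderiv T eta t 0 i
     + force T g z f (curve x) t i * eta t 0 i)) =
  \int[mu]_(t in `[0, T]) (\sum_i euler_lagrange (t, x) i * eta t 0 i).
Proof.
move=> Mx C1e e0 eT.
have C1m i : C1_curve T (fun t => momentum T g z (curve x) t i).
  exact: (smooth_C1_curve T_gt0 (smooth_momentum i) Mx).
have cf i : {within `[0, T], continuous (fun t => force T g z f (curve x) t i)}.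
  exact: (smooth_slice_continuous T_gt0 (smooth_force i) Mx).
have cel i : {within `[0, T], continuous (fun t => euler_lagrange (t, x) i)}.
  exact: (smooth_slice_continuous T_gt0 (smooth_euler_lagrange i) Mx).
have C1ei i : C1_curve T (fun t => eta t 0 i) by exact: (C1_curve_mxP T_gt0 _).1.
have cei i := C1_curve_cont (C1ei i).
have cde i : {within `[0, T], continuous (fun t => tderiv T eta t 0 i)}.
  exact: ((within_continuous_coord _ _).1 C1e.2).
rewrite !Rintegral_sum; last 2 first.
- by move=> i; exact: within_continuousM.
- move=> i; apply: within_continuousD; apply: within_continuousM => //.
  exact: C1_curve_cont.
apply: eq_bigr => i _.
have -> : \int[mu]_(t in `[0, T]) (momentum T g z (curve x) t i * tderiv T eta t 0 i
     + force T g z f (curve x) t i * eta t 0 i) =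
  \int[mu]_(t in `[0, T]) (momentum T g z (curve x) t i * tderiv T (fun s => eta s 0 i) t)
  + \int[mu]_(t in `[0, T]) (force T g z f (curve x) t i * eta t 0 i).
  rewrite -RintegralD//; last 2 first.
  - apply: continuous_integrable.
    exact: within_continuousM (C1_curve_cont (C1m i)) (C1ei i).2.
  - by apply/continuous_integrable/within_continuousM.
  apply: eq_Rintegral => t /[!inE] tT.
  by have [_ ->] := tderiv_coord T_gt0 0 i tT (C1e.1 t tT).
rewrite integral_by_parts//; [|by rewrite e0 mxE|by rewrite eT mxE].
rewrite addrC -RintegralB//; last 2 first.
- by apply/continuous_integrable/within_continuousM.
- by apply: continuous_integrable; exact: within_continuousM (C1m i).2 (cei i).
by apply: eq_Rintegral => t _; rewrite -mulrBl.
Qed.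

Lemma fundamental_lemma x : M x ->
  (forall eta : R -> vec, C1_curve T eta -> eta 0 = 0 -> eta T = 0 ->
    \int[mu]_(t in `[0, T]) (\sum_i euler_lagrange (t, x) i * eta t 0 i) = 0) ->
  forall t i, t \in `[0, T] -> euler_lagrange (t, x) i = 0.
Proof.
move=> Mx H t i tT.
(* The weight t (T - t) vanishes at both ends, making the direction admissible, and is positive
   inside, so the integrand below is the weight times a sum of squares. *)
pose b (p : R * vec) := p.1 * (T - p.1).
have sb : smooth_on A b.
  apply: smooth_onM; first exact: smooth_on_fst.
  by apply: smooth_onD; [exact: smooth_on_cst|apply/smooth_onN/smooth_on_fst].
pose eta s : vec := \row_i (b (s, x) * euler_lagrange (s, x) i).
have C1e : C1_curve T eta.
  apply/(C1_curve_mxP T_gt0) => k j.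
  have := smooth_C1_curve T_gt0 (smooth_onM sb (smooth_euler_lagrange j)) Mx.
  by congr C1_curve; apply/funext => s; rewrite mxE.
have e0 : eta 0 = 0 by apply/rowP => j; rewrite !mxE /b/= !mul0r.
have eT : eta T = 0 by apply/rowP => j; rewrite !mxE /b/= subrr mulr0 mul0r.
pose h s := b (s, x) * \sum_i euler_lagrange (s, x) i ^+ 2.
have sh : smooth_on A (fun p => b p * \sum_i euler_lagrange p i * euler_lagrange p i).
  apply: smooth_onM => //; apply: smooth_on_sum => j.
  by apply: smooth_onM; exact: smooth_euler_lagrange.
have ch : {within `[0, T], continuous h}.
  by have := smooth_slice_continuous T_gt0 sh Mx.
have b0 s : s \in `[0, T] -> 0 <= b (s, x).
  by rewrite in_itv/= => /andP[s0 sT]; rewrite mulr_ge0// subr_ge0.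
have sq0 s : 0 <= \sum_i euler_lagrange (s, x) i ^+ 2.
  by apply: sumr_ge0 => j _; exact: sqr_ge0.
have Ih : \int[mu]_(s in `[0, T]) h s = 0.
  apply: etrans (H eta C1e e0 eT); apply: eq_Rintegral => s _.
  by rewrite /h mulr_sumr; apply: eq_bigr => j _; rewrite mxE expr2 mulrCA.
have h0 := integral0_nonneg T_gt0 ch (fun s sT => mulr_ge0 (b0 s sT) (sq0 s)) Ih.
have cel := smooth_slice_continuous T_gt0 (smooth_euler_lagrange i) Mx.
(* Where the weight vanishes nothing can be concluded directly; the end points are recovered by
   continuity. *)
apply: (within0_itv cel) tT => s sT.
have /eqP := h0 s sT; rewrite mulf_eq0 => /orP[|].
  move: sT; rewrite in_itv/= /b/= => /andP[s0 sT].
  by rewrite mulf_eq0 gt_eqF//= subr_eq0 gt_eqF.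
rewrite psumr_eq0 => [/allP /(_ i)|j _]; last exact: sqr_ge0.
by rewrite mem_index_enum => /(_ isT)/=; rewrite sqrf_eq0 => /eqP.
Qed.

End EulerLagrange.

(** * First-order condition at a local minimum *)

Section Minimum.
Context {R : realType}.

(** Derivability is given at 0 only, so the two inequalities are read from the difference quotients,
    which are nonpositive on the left and nonnegative on the right. *)
Lemma derive_at_local_min (F : R -> R) (l : R) : is_derive (0 : R) (1 : R) F l ->
  (\forall e \near (0 : R), F 0 <= F e) -> l = 0.
Proof.
move=> [dF <-] Fmin.
have FL : \forall e \near (0 : R)^'-, F 0 <= F e by exact: filterS Fmin.
have FR : \forall e \near (0 : R)^'+, F 0 <= F e by exact: filterS Fmin.
have {}dF : h^-1 *: (F (h *: 1 + 0) - F 0) @[h --> (0 : R)^'] --> 'D_1 F 0 by [].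
apply/eqP; rewrite eq_le; apply/andP; split.
  have dl := cvg_dnbhs_at_left dF.
  rewrite -(cvg_lim _ dl)//; apply: limr_le; first by apply/cvg_ex; eexists; exact: dl.
  near=> h; apply: mulr_le0_ge0.
    by rewrite invr_le0 ltW//; near: h; exact: nbhs_left_lt.
  by rewrite subr_ge0 [_%:A]mulr1 addr0; near: h.
have dl := cvg_dnbhs_at_right dF.
rewrite -(cvg_lim _ dl)//; apply: limr_ge; first by apply/cvg_ex; eexists; exact: dl.
near=> h; apply: mulr_ge0.
  by rewrite invr_ge0 ltW//; near: h; exact: nbhs_right_gt.
by rewrite subr_ge0 [_%:A]mulr1 addr0; near: h.
Unshelve. all: by end_near. Qed.

End Minimum.

(** * The flow equation in local coordinates *)

Section GeometrySmooth.
Context {R : realType} {d : nat} (T : R) (M : set 'rV[R]_d).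
Hypotheses (T_gt0 : 0 < T) (oM : open M).
Local Notation vec := 'rV[R]_d.
Local Notation A := (`[0, T] `*` M).
Variable g : R -> vec -> 'M[R]_d.
Hypotheses (sg : forall i j, smooth_on A (fun p => g p.1 p.2 i j)).
Hypothesis g_unit : forall t x, t \in `[0, T] -> M x -> g t x \in unitmx.
Implicit Types (X U Z : R * vec -> vec) (Y : R -> vec -> vec).

Lemma derive_inner t x (v a b : vec) : t \in `[0, T] -> M x ->
  'D_v (fun y => inner (g t) y a b) x =
  \sum_i \sum_j a 0 i * b 0 j * 'D_v (fun y => g t y i j) x.
Proof.
move=> tT Mx.
have dg i j : derivable (fun y => g t y i j) x v.
  exact: (smooth_derivable oM (sg i j) tT Mx).
have -> : (fun y => inner (g t) y a b) =
    \sum_i \sum_j (a 0 i * b 0 j) *: (fun y => g t y i j).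
  apply/funext => y; rewrite inner_sum fct_sumE; apply: eq_bigr => i _.
  rewrite fct_sumE mulr_sumr; apply: eq_bigr => j _.
  by rewrite [RHS]/GRing.scale/= (mulrC (g t y i j)) mulrA.
have dij i j : is_derive x v ((a 0 i * b 0 j) *: (fun y => g t y i j))
    ((a 0 i * b 0 j) *: 'D_v (fun y => g t y i j) x).
  by apply: is_deriveZ; exact: derivableP.
have di i := is_derive_sum (dij i).
by have [_ ->] := is_derive_sum di.
Qed.

(** Together with [derive_inner_linear_r] this supplies the linearity that [inner_sharp] demands of
    the form defining the Christoffel symbols. *)
Lemma derive_inner_linear_dir t x (k : R) (v v' a b : vec) : t \in `[0, T] -> M x ->
  'D_(k *: v + v') (fun y => inner (g t) y a b) x =
  k * 'D_v (fun y => inner (g t) y a b) x + 'D_v' (fun y => inner (g t) y a b) x.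
Proof.
move=> tT Mx; rewrite !derive_inner// mulr_sumr -big_split/=; apply: eq_bigr => i _.
rewrite mulr_sumr -big_split/=; apply: eq_bigr => j _.
rewrite !(smooth_derive_coord oM _ (sg i j) tT Mx).
under eq_bigr do rewrite !mxE mulrDl -mulrA.
by rewrite big_split/= -mulr_sumr; ring.
Qed.

Lemma derive_inner_linear_r t x (k : R) (v a b b' : vec) : t \in `[0, T] -> M x ->
  'D_v (fun y => inner (g t) y a (k *: b + b')) x =
  k * 'D_v (fun y => inner (g t) y a b) x + 'D_v (fun y => inner (g t) y a b') x.
Proof.
move=> tT Mx; rewrite !derive_inner// mulr_sumr -big_split/=; apply: eq_bigr => i _.
rewrite mulr_sumr -big_split/=; apply: eq_bigr => j _.
by rewrite !mxE; ring.
Qed.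

Lemma smooth_derive_inner X U Z : (forall i, smooth_on A (fun p => X p 0 i)) ->
  (forall i, smooth_on A (fun p => U p 0 i)) ->
  (forall i, smooth_on A (fun p => Z p 0 i)) ->
  smooth_on A (fun p => 'D_(X p) (fun y => inner (g p.1) y (U p) (Z p)) p.2).
Proof.
move=> sX sY sZ.
apply: (smooth_on_eq (F := fun p => \sum_i \sum_j U p 0 i * Z p 0 j *
    'D_(X p) (fun y => g p.1 y i j) p.2)).
  by move=> [t x] [/= tT Mx]; rewrite derive_inner.
apply: smooth_on_sum => i; apply: smooth_on_sum => j; apply: smooth_onM.
  exact: smooth_onM.
exact: (smooth_on_derive oM (sg i j) sX).
Qed.

Lemma smooth_cst_coord (a : vec) i : smooth_on A (fun=> a 0 i).
Proof. exact: smooth_on_cst. Qed.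

Lemma smooth_christoffel X U : (forall i, smooth_on A (fun p => X p 0 i)) ->
  (forall i, smooth_on A (fun p => U p 0 i)) ->
  forall k, smooth_on A (fun p => christoffel (g p.1) p.2 (X p) (U p) 0 k).
Proof.
move=> sX sY k; rewrite /christoffel /sharp.
apply: smooth_on_mulmx => [i j|]; last first.
  by apply: smooth_on_invmx => // -[t x] [/= tT Mx]; exact: g_unit.
apply: (smooth_on_eq (F := fun p => 2^-1 *
   ('D_(X p) (fun y => inner (g p.1) y (U p) (Defs.basis j)) p.2
   + 'D_(U p) (fun y => inner (g p.1) y (X p) (Defs.basis j)) p.2
   - 'D_(Defs.basis j) (fun y => inner (g p.1) y (X p) (U p)) p.2))).
  by move=> p _; rewrite mxE.
apply: smooth_onM; first exact: smooth_on_cst.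
apply: smooth_onD; last first.
  apply: smooth_onN; apply: (smooth_derive_inner (X := fun=> Defs.basis j)) => // i'.
  exact: smooth_cst_coord.
apply: smooth_onD.
  apply: (smooth_derive_inner (Z := fun=> Defs.basis j)) => // i'.
  exact: smooth_cst_coord.
apply: (smooth_derive_inner (Z := fun=> Defs.basis j)) => // i'.
exact: smooth_cst_coord.
Qed.

Lemma derivable_field Y t x v : (forall i, smooth_on A (fun p => Y p.1 p.2 0 i)) ->
  t \in `[0, T] -> M x -> derivable (Y t) x v.
Proof.
move=> sY tT Mx; apply/derivable_mxP => i j; rewrite ord1.
exact: (smooth_derivable oM (sY j) tT Mx).
Qed.

Lemma derive_field Y t x v i : (forall i, smooth_on A (fun p => Y p.1 p.2 0 i)) ->
  t \in `[0, T] -> M x -> 'D_v (Y t) x 0 i = 'D_v (fun y => Y t y 0 i) x.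
Proof. by move=> sY tT Mx; rewrite derive_mx ?mxE//; exact: derivable_field. Qed.

Lemma smooth_nabla X Y : (forall i, smooth_on A (fun p => X p 0 i)) ->
  (forall i, smooth_on A (fun p => Y p.1 p.2 0 i)) ->
  forall i, smooth_on A (fun p => nabla (g p.1) (X p) (Y p.1) p.2 0 i).
Proof.
move=> sX sY i.
apply: (smooth_on_eq (F := fun p => 'D_(X p) (fun y => Y p.1 y 0 i) p.2 +
   christoffel (g p.1) p.2 (X p) (Y p.1 p.2) 0 i)).
  by move=> [t x] [/= tT Mx]; rewrite /nabla [RHS]mxE (derive_field _ _ sY tT Mx).
apply: smooth_onD; first exact: (smooth_on_derive oM (sY i) sX).
exact: (smooth_christoffel sX sY).
Qed.

Lemma smooth_diverg Y : (forall i, smooth_on A (fun p => Y p.1 p.2 0 i)) ->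
  smooth_on A (fun p => diverg (g p.1) (Y p.1) p.2).
Proof.
move=> sY; apply: smooth_on_sum => i.
apply: (smooth_nabla (X := fun=> Defs.basis i)) => // j; exact: smooth_cst_coord.
Qed.

Lemma smooth_riemann i j k l :
  smooth_on A (fun p => riemann (g p.1) i j k p.2 0 l).
Proof.
(* The inner covariant derivative is again a smooth time-dependent field, so the same lemma applies
   to the outer one. *)
have s1 i' k' := smooth_nabla (smooth_cst_coord (Defs.basis i'))
  (Y := fun _ => cst (Defs.basis k')) (smooth_cst_coord (Defs.basis k')).
have s2 i' j' := smooth_nabla (smooth_cst_coord (Defs.basis i'))
  (Y := fun t => nabla (g t) (Defs.basis j') (cst (Defs.basis k))) (s1 j' k).
have E (a b : vec) : (a - b) 0 l = a 0 l - b 0 l by rewrite !mxE.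
by apply: (smooth_on_eq _ (smooth_onD (s2 i j l) (smooth_onN (s2 j i l)))) => p _; rewrite /riemann E.
Qed.

Lemma smooth_scalar_curvature :
  smooth_on A (fun p => scalar_curvature (g p.1) p.2).
Proof.
apply: smooth_on_sum => j; apply: smooth_on_sum => k; apply: smooth_onM.
  by apply: smooth_on_invmx => // -[t x] [/= tT Mx]; exact: g_unit.
by apply: smooth_on_sum => i; exact: smooth_riemann.
Qed.

End GeometrySmooth.

Section FlowEquation.
Context {R : realType} {d : nat} (T : R) (M : set 'rV[R]_d).
Hypotheses (T_gt0 : 0 < T) (oM : open M).
Local Notation vec := 'rV[R]_d.
Local Notation A := (`[0, T] `*` M).
Variables (g : R -> vec -> 'M[R]_d) (z w : R -> vec -> vec) (f : R -> vec -> R).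
Hypotheses (sg : forall i j, smooth_on A (fun p => g p.1 p.2 i j)).
Hypothesis g_unit : forall t x, t \in `[0, T] -> M x -> g t x \in unitmx.
Hypothesis g_sym : forall t x i j, t \in `[0, T] -> M x -> g t x i j = g t x j i.
Hypotheses (sz : forall i, smooth_on A (fun p => z p.1 p.2 0 i)).
Hypotheses (sw : forall i, smooth_on A (fun p => w p.1 p.2 0 i)).
Hypotheses (sf : smooth_on A (fun p => f p.1 p.2)).

Local Notation gdot t x := (tderiv T (fun s => g s x) t).

(** Stated for an arbitrary family g; when g is [metric sigma] the third term is [gdot_star] up to
    unfolding. *)
Definition flow_defect t x : vec :=
  tderiv T (fun s => w s x) t + nabla (g t) (w t x + z t x) (w t) x
  + sharp (g t x) (fun v => inner (fun x => gdot t x) x (w t x) v)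
  + nabla_adj (g t) (z t) x (w t x) - grad (g t) (f t) x.

Definition flat t x i : R := \sum_j g t x i j * w t x 0 j.

Lemma sharp_mul (B : 'M[R]_d) (l : vec -> R) k : B \in unitmx ->
  (sharp B l *m B) 0 k = l (Defs.basis k).
Proof. by move=> uB; rewrite /sharp mulmxKV// mxE. Qed.

Lemma inner_sym t x v v' : t \in `[0, T] -> M x ->
  inner (g t) x v v' = inner (g t) x v' v.
Proof.
move=> tT Mx; rewrite !inner_sum.
under eq_bigr do rewrite mulr_sumr.
rewrite exchange_big/=; apply: eq_bigr => i _; rewrite mulr_sumr.
by apply: eq_bigr => j _; rewrite (g_sym i j)//; ring.
Qed.

Lemma derive_inner_sym t x v a b : t \in `[0, T] -> M x ->
  'D_v (fun y => inner (g t) y a b) x = 'D_v (fun y => inner (g t) y b a) x.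
Proof.
move=> tT Mx; apply: near_eq_derive; near=> y; apply: inner_sym => //.
by near: y; exact: open_nbhs_nbhs.
Unshelve. all: by end_near. Qed.

Lemma gdot_coord t x i j : t \in `[0, T] -> M x ->
  gdot t x i j = tderiv T (fun s => g s x i j) t.
Proof.
move=> tT Mx.
have dg : tderivable T (fun s => g s x) t.
  apply: (tderiv_mx T_gt0 tT) => k l; exact: (smooth_tderivable T_gt0 (sg k l) tT Mx).
by have [_ ->] := tderiv_coord T_gt0 i j tT dg.
Qed.

Lemma gdot_sym t x i j : t \in `[0, T] -> M x -> gdot t x i j = gdot t x j i.
Proof.
move=> tT Mx; rewrite !gdot_coord//; apply: eq_tderiv => // s sT.
exact: g_sym.
Qed.

Lemma wdot_coord t x i : t \in `[0, T] -> M x ->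
  tderiv T (fun s => w s x) t 0 i = tderiv T (fun s => w s x 0 i) t.
Proof.
move=> tT Mx.
have dw : tderivable T (fun s => w s x) t.
  apply: (tderiv_mx T_gt0 tT) => k l; rewrite ord1.
  exact: (smooth_tderivable T_gt0 (sw l) tT Mx).
by have [_ ->] := tderiv_coord T_gt0 0 i tT dw.
Qed.

Lemma smooth_flat i : smooth_on A (fun p => flat p.1 p.2 i).
Proof. by apply: smooth_on_sum => j; exact: smooth_onM. Qed.

Lemma derive_flat t x v k : t \in `[0, T] -> M x ->
  'D_v (fun y => flat t y k) x =
  \sum_j (g t x k j * 'D_v (fun y => w t y 0 j) x
     + w t x 0 j * 'D_v (fun y => g t y k j) x).
Proof.
move=> tT Mx.
have dg j : derivable (fun y => g t y k j) x v.
  exact: (smooth_derivable oM (sg k j) tT Mx).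
have dw j : derivable (fun y => w t y 0 j) x v.
  exact: (smooth_derivable oM (sw j) tT Mx).
have dj j := is_deriveM (derivableP (dg j)) (derivableP (dw j)).
have -> : (fun y => flat t y k) =
    \sum_j ((fun y => g t y k j) * (fun y => w t y 0 j)).
  by apply/funext => y; rewrite fct_sumE.
by have [_ ->] := is_derive_sum dj.
Qed.

Lemma tderivM_smooth (F G : R * vec -> R) t x : smooth_on A F -> smooth_on A G ->
  t \in `[0, T] -> M x ->
  tderiv T (fun s => F (s, x) * G (s, x)) t =
  F (t, x) * tderiv T (fun s => G (s, x)) t + G (t, x) * tderiv T (fun s => F (s, x)) t.
Proof.
move=> sF sG tT Mx.
(* A Boolean index puts the extensions of both factors on one open set, where the ordinary product
   rule in the direction (1, 0) holds. *)
have [ O [E [oO AO CE FE]]] := common_extension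
  (F := fun b : bool => if b then F else G) (fun b => if b return smooth_on A (if b then F else G) then sF else sG).
have Otx : O (t, x) by apply: AO.
have EF p : A p -> F p = E true p by exact: FE true p.
have EG p : A p -> G p = E false p by exact: FE false p.
have CM n := Cle_mul oO (CE true n) (CE false n).
have EM p : A p -> F p * G p = E true p * E false p by move=> Ap; rewrite EF// EG.
have [_ ->] := slice_time (F := fun p => F p * G p) T_gt0 oO AO CM EM tT Mx.
have [_ ->] := slice_time T_gt0 oO AO (CE true) EF tT Mx.
have [_ ->] := slice_time T_gt0 oO AO (CE false) EG tT Mx.
have dF : derivable (E true) (t, x) (1, 0) by exact: ((CE true 1%N).2 (1, 0)).1 _ Otx.
have dG : derivable (E false) (t, x) (1, 0) by exact: ((CE false 1%N).2 (1, 0)).1 _ Otx.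
have Atx : A (t, x) by [].
by rewrite (EF _ Atx) (EG _ Atx); exact: (deriveM dF dG).
Qed.

Lemma tderiv_sum_smooth (I : Type) (r : seq I) (F : I -> R * vec -> R) t x :
  (forall i, smooth_on A (F i)) -> t \in `[0, T] -> M x ->
  tderiv T (fun s => \sum_(i <- r) F i (s, x)) t =
  \sum_(i <- r) tderiv T (fun s => F i (s, x)) t.
Proof.
move=> sF tT Mx; elim: r => [|i r IH].
  rewrite big_nil; under [X in tderiv _ X]eq_fun do rewrite big_nil.
  have [_ ->] := tderiv_extend (f := fun=> 0 : R) (g := cst 0) T_gt0 tT (fun _ _ => erefl)
    (derivable_cst _ _ _).
  exact: derive_cst.
rewrite big_cons -IH; under [X in tderiv _ X]eq_fun do rewrite big_cons.
have sr : smooth_on A (fun p => \sum_(i <- r) F i p) by exact: smooth_on_sum.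
have [_ ->] := tderivD T_gt0 tT (smooth_tderivable T_gt0 (sF i) tT Mx)
  (smooth_tderivable T_gt0 sr tT Mx).
by [].
Qed.

Lemma tderiv_flat t x k : t \in `[0, T] -> M x ->
  tderiv T (fun s => flat s x k) t =
  \sum_j (g t x k j * tderiv T (fun s => w s x) t 0 j + w t x 0 j * gdot t x k j).
Proof.
move=> tT Mx.
rewrite (tderiv_sum_smooth _ (F := fun j p => g p.1 p.2 k j * w p.1 p.2 0 j))//; last first.
  by move=> j; exact: smooth_onM.
apply: eq_bigr => j _; rewrite wdot_coord// gdot_coord//.
exact: (tderivM_smooth (sg k j) (sw j) tT Mx).
Qed.

Lemma inner_basis (B : vec -> 'M[R]_d) x v k :
  inner B x v (Defs.basis k) = \sum_i v 0 i * B x i k.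
Proof.
rewrite /inner /Defs.basis trmx_delta -colE mxE.
by rewrite mxE; apply: eq_bigr.
Qed.

Lemma inner_linear_l t x (v v' u : vec) :
  inner (g t) x (v + v') u = inner (g t) x v u + inner (g t) x v' u.
Proof. by rewrite /inner !mulmxDl mxE. Qed.

Lemma flow_defect_flat t x k : t \in `[0, T] -> M x ->
  (flow_defect t x *m g t x) 0 k =
  tderiv T (fun s => flat s x k) t + 'D_(w t x + z t x) (fun y => flat t y k) x
  - (2^-1 * (\sum_i \sum_j 'D_(Defs.basis k) (fun y => g t y i j) x * (w t x 0 i * w t x 0 j))
     - \sum_i flat t x i * 'D_(Defs.basis k) (fun y => z t y 0 i) x
     + 'D_(Defs.basis k) (fun y => f t y) x).
Proof.
move=> tT Mx.
pose e := Defs.basis k : vec; pose W := w t x; pose Z := z t x.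
pose b v a c := 'D_v (fun y => inner (g t) y a c) x.
have bDv v v' a c : b (v + v') a c = b v a c + b v' a c.
  by have := derive_inner_linear_dir oM sg 1 v v' a c tT Mx; rewrite scale1r mul1r.
have bDr v a c c' : b v a (c + c') = b v a c + b v a c'.
  by have := derive_inner_linear_r oM sg 1 v a c c' tT Mx; rewrite scale1r mul1r.
have bS v a c : b v a c = b v c a by exact: derive_inner_sym.
have bDm v a a' c : b v (a + a') c = b v a c + b v a' c.
  by rewrite bS bDr !(bS v c).
have uG := g_unit tT Mx.
have E1 : (tderiv T (fun s => w s x) t *m g t x) 0 k =
    \sum_j g t x k j * tderiv T (fun s => w s x) t 0 j.
  by rewrite mxE; apply: eq_bigr => j _; rewrite (g_sym k j)// mulrC.
have E2 : ('D_(W + Z) (w t) x *m g t x) 0 k =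
    \sum_j g t x k j * 'D_(W + Z) (fun y => w t y 0 j) x.
  rewrite mxE; apply: eq_bigr => j _.
  by rewrite (g_sym k j)// mulrC (derive_field oM _ _ sw tT Mx).
have E3 : (christoffel (g t) x (W + Z) W *m g t x) 0 k =
    2^-1 * (b (W + Z) W e + b W (W + Z) e - b e (W + Z) W) by exact: sharp_mul.
have E4 : (sharp (g t x) (fun v => inner (fun x => gdot t x) x (w t x) v) *m g t x) 0 k
    = \sum_j w t x 0 j * gdot t x k j.
  rewrite sharp_mul// inner_basis; apply: eq_bigr => j _.
  by rewrite gdot_sym.
(* Adding the Christoffel terms of E3 and E5, the derivatives of g(Z, e) along W and of g(Z, W)
   along e cancel, while the two halves of the derivative of g(W, e) along Z combine. *)
have E5 : (nabla_adj (g t) (z t) x W *m g t x) 0 k =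
    \sum_i flat t x i * 'D_e (fun y => z t y 0 i) x
    + 2^-1 * (b e Z W + b Z e W - b W e Z).
  rewrite sharp_mul// inner_linear_l; congr (_ + _).
    rewrite inner_sum; apply: eq_bigr => i _; rewrite mulrC.
    by rewrite (derive_field oM _ _ sz tT Mx).
  rewrite inner_sharp// => a v1 v2.
  rewrite !(derive_inner_linear_r oM sg a _ _ v1 v2 tT Mx).
  by rewrite (derive_inner_linear_dir oM sg a v1 v2 _ _ tT Mx); ring.
have E6 : (grad (g t) (f t) x *m g t x) 0 k = 'D_e (fun y => f t y) x by exact: sharp_mul.
(* As e is a basis vector only one row of the double sum survives; it is the part of the derivative
   of [flat] in which g is differentiated. *)
have E7 : b (W + Z) W e = \sum_j w t x 0 j * 'D_(W + Z) (fun y => g t y k j) x.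
  rewrite bS /b (derive_inner oM sg _ _ _ tT Mx) (bigD1 k)//= [X in _ + X]big1 ?addr0.
    by apply: eq_bigr => j _; rewrite /e /Defs.basis mxE !eqxx mul1r.
  move=> i ik; rewrite big1// => j _.
  by rewrite /e /Defs.basis mxE eqxx (negbTE ik) !mul0r.
have E8 : b e W W = \sum_i \sum_j 'D_e (fun y => g t y i j) x * (w t x 0 i * w t x 0 j).
  rewrite /b (derive_inner oM sg _ _ _ tT Mx); apply: eq_bigr => i _; apply: eq_bigr => j _.
  by rewrite mulrC.
have mD (B C : vec) : ((B + C) *m g t x) 0 k = (B *m g t x) 0 k + (C *m g t x) 0 k.
  by rewrite mulmxDl mxE.
have mN (B : vec) : ((- B) *m g t x) 0 k = - (B *m g t x) 0 k.
  by rewrite mulNmx mxE.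
rewrite /flow_defect /nabla !mD mN E1 E2 E3 E4 E5 E6.
rewrite tderiv_flat// derive_flat// !big_split/= -E7 -E8.
rewrite -/e -/W -/Z !bDv !bDm (bS Z e W) (bS W e Z).
by field.
Qed.

End FlowEquation.

(** * The Onsager-Machlup functional *)

Section Diffusion.
Context {R : realType} {d J : nat} (T : R) (M : set 'rV[R]_d).
Hypotheses (T_gt0 : 0 < T) (oM : open M).
Local Notation vec := 'rV[R]_d.
Local Notation A := (`[0, T] `*` M).
Variables (sigma : 'I_J -> R -> vec -> vec) (z : R -> vec -> vec).
Hypothesis ssigma : forall r i, smooth_on A (fun p => sigma r p.1 p.2 0 i).
Hypothesis sz : forall i, smooth_on A (fun p => z p.1 p.2 0 i).
Hypothesis sigma_spans : spanning T M sigma.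

Lemma cometricE t x :
  cometric sigma t x = (\matrix_(r < J) sigma r t x)^T *m \matrix_(r < J) sigma r t x.
Proof.
apply/matrixP => i j; rewrite /cometric summxE mxE; apply: eq_bigr => r _.
by rewrite !mxE big_ord1 !mxE.
Qed.

(** The cometric is the Gram matrix S^T S. If v S^T S = 0 then |v S^T|^2 = 0, and S^T has trivial
    left kernel because the rows of S span. *)
Lemma cometric_unit t x : t \in `[0, T] -> M x -> cometric sigma t x \in unitmx.
Proof.
move=> tT Mx; rewrite cometricE; set S := \matrix_(r < J) sigma r t x.
have Sfull : row_full S by exact: sigma_spans.
rewrite -row_free_unit -kermx_eq0; apply/eqP/row_matrixP => i; rewrite row0.
set v := row i _.
have vS : v *m (S^T *m S) = 0 by apply/sub_kermxP; exact: row_sub.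
have Sv : v *m S^T = 0.
  have n0 : \sum_r (v *m S^T) 0 r ^+ 2 = 0.
    have : (v *m S^T *m (v *m S^T)^T) 0 0 = 0.
      by rewrite trmx_mul trmxK mulmxA -[v *m S^T *m S]mulmxA vS mul0mx mxE.
    rewrite mxE => E0; apply: etrans E0; apply: eq_bigr => r _.
    by rewrite expr2 [_^T _ _]mxE.
  apply/rowP => r; rewrite [RHS]mxE.
  move/eqP: n0; rewrite psumr_eq0 => [/allP /(_ r)|k _]; last exact: sqr_ge0.
  by rewrite mem_index_enum => /(_ isT)/=; rewrite sqrf_eq0 => /eqP.
have ST : row_free S^T by rewrite /row_free mxrank_tr.
by apply/eqP; rewrite -(mulmx_free_eq0 _ ST) Sv.
Qed.

Lemma metric_unit t x : t \in `[0, T] -> M x -> metric sigma t x \in unitmx.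
Proof. by move=> tT Mx; rewrite unitmx_inv cometric_unit. Qed.

(** Transposition commutes with [invmx] on all matrices, hence the absence of conditions on t and
    x. *)
Lemma metric_sym t x i j : metric sigma t x i j = metric sigma t x j i.
Proof.
have : (metric sigma t x)^T = metric sigma t x.
  by rewrite /metric trmx_inv cometricE trmx_mul trmxK.
by move=> {2}<-; rewrite mxE.
Qed.

Lemma smooth_metric i j : smooth_on A (fun p => metric sigma p.1 p.2 i j).
Proof.
apply: smooth_on_invmx => [[t x] [/= tT Mx]|k l]; first exact: cometric_unit.
apply: (smooth_on_eq (F := fun p => \sum_r sigma r p.1 p.2 0 k * sigma r p.1 p.2 0 l)).
  move=> p _; rewrite /cometric summxE; apply: eq_bigr => r _.
  by rewrite mxE big_ord1 mxE.
by apply: smooth_on_sum => r; exact: smooth_onM.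
Qed.

Lemma smooth_potential : smooth_on A (fun p => potential T sigma z p.1 p.2).
Proof.
have s1 := smooth_diverg oM smooth_metric metric_unit sz.
have s2 := smooth_scalar_curvature oM smooth_metric metric_unit.
rewrite /potential; apply: smooth_onD; first apply: smooth_onD.
- by apply: smooth_onM => //; exact: smooth_on_cst.
- by apply: smooth_onN; apply: smooth_onM => //; exact: smooth_on_cst.
- apply: smooth_onM; first exact: smooth_on_cst.
  apply: smooth_on_sum => i; apply: smooth_on_mulmx => [k l|k l].
    apply: smooth_on_eq (smooth_on_tderiv T_gt0 (smooth_metric k l)) => -[t x] [/= tT Mx].
    by rewrite /metric_dot (gdot_coord T_gt0 smooth_metric k l tT Mx).
  apply: smooth_on_invmx => [[t x] [/= tT Mx]|k' l']; first exact: metric_unit.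
  exact: smooth_metric.
Qed.

Local Notation g := (metric sigma).
Local Notation f := (potential T sigma z).
Local Notation mu := (@lebesgue_measure R).

Lemma C1_curve_variation (c eta : R -> vec) (e : R) : C1_curve T c -> C1_curve T eta ->
  C1_curve T (fun t => c t + e *: eta t) /\
  forall t, t \in `[0, T] ->
    tderiv T (fun t => c t + e *: eta t) t = tderiv T c t + e *: tderiv T eta t.
Proof.
move=> [dc cc] [de ce].
have H t : t \in `[0, T] -> tderivable T (fun t => c t + e *: eta t) t /\
    tderiv T (fun t => c t + e *: eta t) t = tderiv T c t + e *: tderiv T eta t.
  move=> tT; have [dZ EZ] := tderivZ T_gt0 e tT (de t tT).
  by have [dD ED] := tderivD T_gt0 tT (dc t tT) dZ; rewrite ED EZ.
split=> [|t /H[]//]; split=> [t /H[]//|].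
apply: (eq_within_continuous (f := fun t => tderiv T c t + e *: tderiv T eta t)).
  by move=> t tT; rewrite (H t tT).2.
apply/subspace_continuousP => t tT; apply: cvgD.
  by have /subspace_continuousP := cc; exact.
by apply: cvgZl_tmp; have /subspace_continuousP := ce; exact.
Qed.

Lemma OM_variation (c eta : R -> vec) : path_in T M c -> C1_curve T eta ->
  is_derive (0 : R) (1 : R) (fun e : R => OM_functional T sigma z (fun t => c t + e *: eta t))
    (\int[mu]_(t in `[0, T]) (\sum_i (momentum T g z c t i * tderiv T eta t 0 i
       + force T g z f c t i * eta t 0 i))).
Proof.
move=> pc C1e.
have gs t x i j : t \in `[0, T] -> M x -> g t x i j = g t x j i by move=> _ _; exact: metric_sym.
have := lagrangian_varies T_gt0 oM smooth_metric sz smooth_potential gs pc C1e.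
move=> /(varies_integral T_gt0 oM pc C1e).
suff -> : (fun e : R => OM_functional T sigma z (fun t => c t + e *: eta t)) =
  (fun e => \int[mu]_(t in `[0, T]) (2^-1 * inner (g t) (c t + e *: eta t)
        (tderiv T c t + e *: tderiv T eta t - z t (c t + e *: eta t))
        (tderiv T c t + e *: tderiv T eta t - z t (c t + e *: eta t))
      + f t (c t + e *: eta t))) by [].
(* The velocity of the varied curve splits into that of [c] and of [eta] on [0, T], which is all
   that the integral sees. *)
apply/funext => e; apply: eq_Rintegral => t /[!inE] tT.
have [_ E] := C1_curve_variation e pc.1 C1e.
by rewrite /OM_lagrangian E.
Qed.

(** For small e the variation is itself a competitor: it is C^1, stays in M and keeps the end
    points. So e = 0 is a local minimum of a derivable function. *)
Lemma most_probable_stationary (c : R -> vec) :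
  most_probable_path T M sigma z c -> stationary_path T M sigma z c.
Proof.
move=> [pc Hmin]; split=> // eta C1e e0 eT.
have D := OM_variation pc C1e.
suff E : \int[mu]_(t in `[0, T]) (\sum_i (momentum T g z c t i * tderiv T eta t 0 i
   + force T g z f c t i * eta t 0 i)) = 0 by rewrite E in D.
apply: (derive_at_local_min D).
have := variation_in T_gt0 oM pc C1e; apply: filterS => e He.
have -> : (fun t => c t + 0 *: eta t) = c by apply/funext => t; rewrite scale0r addr0.
apply: Hmin; [split|by rewrite e0 scaler0 addr0|by rewrite eT scaler0 addr0].
  exact: (C1_curve_variation e pc.1 C1e).1.
exact: He.
Qed.

Variables phi psi : R -> vec -> vec.
Hypotheses (sphi : forall i, smooth_on A (fun p => phi p.1 p.2 0 i)).
Hypotheses (spsi : forall i, smooth_on A (fun p => psi p.1 p.2 0 i)).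
Hypothesis phi_psi : forall t x, t \in `[0, T] -> M x ->
  [/\ M (phi t x), M (psi t x), psi t (phi t x) = x & phi t (psi t x) = x].

Let Mphi t x (tT : t \in `[0, T]) (Mx : M x) : M (phi t x).
Proof. by have [] := phi_psi tT Mx. Qed.

Lemma stationary_flowP : stationary_flow T M sigma z phi <->
  forall t x i, t \in `[0, T] -> M x -> euler_lagrange T g z f phi (t, x) i = 0.
Proof.
have parts x := variation_by_parts T_gt0 oM smooth_metric sz smooth_potential sphi Mphi
  (x := x).
have pathx x Mx := flow_path T_gt0 sphi Mphi (x := x) Mx.
split=> [H t x i tT Mx|H x Mx].
  apply: (fundamental_lemma T_gt0 oM smooth_metric sz smooth_potential sphi Mphi Mx) tT.
  move=> eta C1e e0 eT; rewrite -parts//.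
  have [_ /(_ eta C1e e0 eT)[_ D0]] := H x Mx.
  by have [_ D] := OM_variation (pathx x Mx) C1e; rewrite -D.
split; first exact: pathx.
move=> eta C1e e0 eT; have := OM_variation (pathx x Mx) C1e.
rewrite parts//.
suff -> : \int[mu]_(t in `[0, T]) (\sum_i euler_lagrange T g z f phi (t, x) i * eta t 0 i)
  = \int[mu]_(t in `[0, T]) (0 : R).
  by rewrite Rintegral_cst ?mul0r//; exact: measurable_itv.
apply: eq_Rintegral => t /[!inE] tT.
by rewrite big1// => i _; rewrite H// mul0r.
Qed.

(* Along the flow of [w + z], the momentum is the covector [w^flat]. *)
Lemma euler_lagrange_flow_defect (w : R -> vec -> vec) :
  (forall i, smooth_on A (fun p => w p.1 p.2 0 i)) ->
  (forall t x, t \in `[0, T] -> M x ->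
    tderiv T (fun s => phi s x) t = w t (phi t x) + z t (phi t x)) ->
  forall t x k, t \in `[0, T] -> M x ->
  euler_lagrange T g z f phi (t, x) k
    = - (flow_defect T g z w f t (phi t x) *m g t (phi t x)) 0 k.
Proof.
move=> sw Hw t x k tT Mx.
have gs s y i j : s \in `[0, T] -> M y -> g s y i j = g s y j i by move=> _ _; exact: metric_sym.
have Mp := Mphi tT Mx.
have slipE s i : s \in `[0, T] -> slip T z (fun t => phi t x) s i = w s (phi s x) 0 i.
  by move=> sT; rewrite /slip Hw// mxE addrK.
have momE s i : s \in `[0, T] -> momentum T g z (fun t => phi t x) s i = flat g w s (phi s x) i.
  by move=> sT; apply: eq_bigr => j _; rewrite slipE.
rewrite (flow_defect_flat T_gt0 oM f smooth_metric metric_unit gs sz sw k tT Mp) opprB.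
rewrite /euler_lagrange/= (eq_tderiv tT (fun s => momE s k)).
have sfl := smooth_flat smooth_metric sw k.
(* The momentum is the covector field g w evaluated along the trajectory, so its derivative splits
   into the time derivative at a fixed point and the derivative along w + z, the two leading terms
   of [flow_defect_flat]. *)
rewrite (tderiv_flow (F := fun p => flat g w p.1 p.2 k) T_gt0 oM sfl sphi Mphi tT Mx)/=.
rewrite Hw//; congr (_ - _); rewrite /force; congr (_ * _ - _ + _).
  by apply: eq_bigr => i _; apply: eq_bigr => j _; rewrite !slipE.
by apply: eq_bigr => i _; rewrite momE.
Qed.

Lemma flow_defect_eq0 (w : R -> vec -> vec) t x : t \in `[0, T] -> M x ->
  (forall k, (flow_defect T g z w f t x *m g t x) 0 k = 0) <->
  tderiv T (fun s => w s x) t + nabla (g t) (w t x + z t x) (w t) x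
  + gdot_star T sigma t x (w t x) + nabla_adj (g t) (z t) x (w t x)
  = grad (g t) (f t) x.
Proof.
move=> tT Mx; split=> [H|E k].
  apply/subr0_eq; rewrite -[LHS](mulmxK (metric_unit tT Mx)).
  have -> : flow_defect T g z w f t x *m g t x = 0.
    by apply/rowP => k; rewrite H mxE.
  by rewrite mul0mx.
rewrite /flow_defect; have -> := E.
by rewrite subrr mul0mx mxE.
Qed.

(** E at (t, x) is minus the lowered defect at the point [phi t x]. One direction reads the equation
    along trajectories; the other has to reach every point of M, which surjectivity of [phi t]
    provides. *)
Lemma solves_flow_equationP : solves_flow_equation T M sigma z phi <->
  forall t x i, t \in `[0, T] -> M x -> euler_lagrange T g z f phi (t, x) i = 0.
Proof.
split=> [[w [sw Hw Heq]] t x i tT Mx|H].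
  have {}sw k : smooth_on A (fun p => w p.1 p.2 0 k).
    exact: (smooth_on_mxP _ _).1 sw 0 k.
  rewrite (euler_lagrange_flow_defect sw Hw)//.
  have Mp := Mphi tT Mx.
  by rewrite ((flow_defect_eq0 w tT Mp).2 (Heq _ _ tT Mp)) oppr0.
(* The only candidate on M: the velocity of the flow at the point y, reached from [psi t y], minus
   the drift. Smoothness of [psi] makes it a smooth field. *)
pose w t y : vec := tderiv T (fun s => phi s (psi t y)) t - z t y.
have sw k : smooth_on A (fun p => w p.1 p.2 0 k).
  have Mpsi t x : t \in `[0, T] -> M x -> M (psi t x).
    by move=> tT Mx; have [] := phi_psi tT Mx.
  have sv := smooth_on_flow (smooth_velocity T_gt0 sphi Mphi k) spsi Mpsi.
  apply: (smooth_on_eq _ (smooth_onD sv (smooth_onN (sz k)))) => p _.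
  by rewrite [RHS]mxE [X in _ = _ + X]mxE.
have Hw t x : t \in `[0, T] -> M x ->
    tderiv T (fun s => phi s x) t = w t (phi t x) + z t (phi t x).
  by move=> tT Mx; have [_ _ E _] := phi_psi tT Mx; rewrite /w E subrK.
exists w; split=> // [|t y tT My].
  by apply/smooth_on_mxP => i j; rewrite ord1.
(* The equation at y is the vanishing of E on the trajectory through y at time t, the one that
   starts from the label [psi t y]. *)
have [_ Mx _ E] := phi_psi tT My.
apply/(flow_defect_eq0 w tT My) => k.
have := euler_lagrange_flow_defect sw Hw k tT Mx.
by rewrite H// E => /eqP; rewrite eq_sym oppr_eq0 => /eqP.
Qed.

End Diffusion.

Theorem theorem3p1 (R : realType) (d J : nat) (M : set 'rV[R]_d) (T : R)
    (u : R -> 'rV[R]_d -> 'rV[R]_d)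
    (sigma : 'I_J -> R -> 'rV[R]_d -> 'rV[R]_d)
    (z phi : R -> 'rV[R]_d -> 'rV[R]_d)
    (M_domain : domain M) (T_gt0 : 0 < T)
    (u_smooth : time_vector_field T M u)
    (sigma_smooth : forall r, time_vector_field T M (sigma r))
    (sigma_spans : spanning T M sigma)
    (z_smooth : time_vector_field T M z)
    (z_drift : generator_drift T M u sigma z)
    (phi_diffeo : diffeo_curve T M phi) :
  (most_probable_flow T M sigma z phi -> solves_flow_equation T M sigma z phi)
  /\ (solves_flow_equation T M sigma z phi <-> stationary_flow T M sigma z phi).
Proof.
have [oM _ _] := M_domain.
have [psi [phi_smooth psi_smooth phi_psi]] := phi_diffeo.
have ssigma r i := (smooth_on_mxP _ _).1 (sigma_smooth r) 0 i.
have sz i := (smooth_on_mxP _ _).1 z_smooth 0 i.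
have sphi i := (smooth_on_mxP _ _).1 phi_smooth 0 i.
have spsi i := (smooth_on_mxP _ _).1 psi_smooth 0 i.
have stationaryP := stationary_flowP T_gt0 oM ssigma sz sigma_spans sphi phi_psi.
have solvesP := solves_flow_equationP T_gt0 oM ssigma sz sigma_spans sphi spsi phi_psi.
split; last by rewrite solvesP stationaryP.
move=> mp; apply/solvesP/stationaryP => x Mx.
exact: (most_probable_stationary T_gt0 oM ssigma sz sigma_spans (mp x Mx)).
Qed.
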